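(* In the limit $N\to\infty$, the fourth moment of the normalised level density $$m_4(\sigma_{N,b})=\int_{-\infty}^{\infty}x^4\,\sigma_{N,b}(dx)$$ of a real symmetric banded (RSB) Wigner ensemble satisfying a four moment condition (the ensemble $\mathrm{BWE}_{N,b}$ of dimension $N$ and bandwidth $b$) has two critical points $$\partial_b\, m_4(\sigma_{N,b})=0$$ found at $$b=\left(\frac{3N}{2}\right)^{\frac12}+o\left(N^{\frac12}\right)$$ and $$b=\frac{2}{5}N+o(N).$$
   Context: An $N\times N$ random matrix $H=(h_{ij})$ is a real symmetric banded (RSB) Wigner matrix with bandwidth $b$ if: (1) $H$ is real symmetric; (2) the upper triangular elements $h_{ij}$, $i\le j$, are jointly independent real random variables; (3) for $|i-j|<b$, $\mathbb{E}h_{ij}=0$ and $\mathbb{E}h_{ij}^2=1$; (4) for $|i-j|\ge b$, $h_{ij}=0$. The four moment condition is that, for $|i-j|<b$, the first four moments of $h_{ij}$ match those of a standard Gaussian, i.e. additionally $\mathbb{E}h_{ij}^3=0$ and $\mathbb{E}h_{ij}^4=3$. The ensemble of such matrices is denoted $\mathrm{BWE}_{N,b}$. The level density (one-point correlation function) $\rho_N$ of $H$ is the unique measure on $\mathbb{R}$ with $\int f\,d\rho_N=\sum_{i=1}^N\mathbb{E}f(\lambda_i)$ for all continuous compactly supported $f:\mathbb{R}\to\mathbb{R}$, where $\lambda_1,\dots,\lambda_N$ are the ordered eigenvalues of $H$. Its moments are $m_k(\rho_N)=\int x^k\rho_N(dx)=\mathbb{E}\operatorname{tr}(H^k)$. The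 normalised level density, written $\sigma_N$ or, to show the bandwidth, $\sigma_{N,b}$, is the rescaling $\sigma_N(x)=\nu\rho_N(\eta x)$ with $\eta=\sqrt{m_2(\rho_N)/m_0(\rho_N)}$ and $\nu=\sqrt{m_2(\rho_N)/m_0(\rho_N)^3}$, chosen so that $m_0(\sigma_N)=m_2(\sigma_N)=1$, i.e. so that $\sigma_N$ is a probability measure with variance $1$. Consequently $$m_4(\sigma_{N,b})=\frac{N\,\mathbb{E}\operatorname{tr}(H^4)}{\left(\mathbb{E}\operatorname{tr}(H^2)\right)^2}.$$ Here $m_4(\sigma_{N,b})$ is considered as a function of the bandwidth $b$, and $\partial_b$ denotes the derivative with respect to $b$. *)

(* Defs.v *)
From HB Require Import structures.
From mathcomp Require Export all_boot all_order all_algebra.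
From mathcomp Require Export all_classical all_reals all_analysis.
Export Order.TTheory GRing.Theory Num.Theory.
Export numFieldNormedType.Exports.

Set Implicit Arguments.
Unset Strict Implicit.
Unset Printing Implicit Defensive.

Local Open Scope classical_set_scope.
Local Open Scope ring_scope.

Definition mutually_independent (R : realType) (d : measure_display)
    (T : measurableType d) (P : probability T R) (I : finType) (D : {set I})
    (X : I -> {RV P >-> R}) : Prop :=
  forall (J : {set I}) (B : I -> set R), J \subset D ->
    (forall i, measurable (B i)) ->
    P (\bigcap_(i in [set` J]) (X i @^-1` B i)) =
      (\prod_(i in J) P (X i @^-1` B i))%E.

Section BandedWigner.
Context (R : realType) (d : measure_display) (T : measurableType d).
Context (P : probability T R) (N : nat).
Implicit Types h : 'I_N -> 'I_N -> {RV P >-> R}.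

Definition banded_wigner (b : nat) h : Prop :=
  [/\ forall i j t, h i j t = h j i t,
      mutually_independent [set ij : 'I_N * 'I_N | (ij.1 <= ij.2)%N]%SET
        (fun ij => h ij.1 ij.2),
      forall i j : 'I_N, (`|i - j| < b)%N ->
        ('E_P[h i j] = 0 /\ 'E_P[fun t => (h i j t ^+ 2)%R] = 1)%E &
      forall i j : 'I_N, (b <= `|i - j|)%N -> forall t, h i j t = 0].

Definition four_moment (b : nat) h : Prop :=
  forall i j : 'I_N, (`|i - j| < b)%N ->
    ('E_P[fun t => (h i j t ^+ 3)%R] = 0 /\
     'E_P[fun t => (h i j t ^+ 4)%R] = 3%:E)%E.

Definition random_matrix h (t : T) : 'M[R]_N := \matrix_(i, j) h i j t.

End BandedWigner.

(* The nondecreasing list of the roots of the characteristic polynomial, with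
   multiplicity; the default value is reached only if it does not split. *)
Definition spectrum (R : realType) (N : nat) (A : 'M[R]_N) : N.-tuple R :=
  xget [tuple of nseq N 0]
    [set s : N.-tuple R | sorted <=%R s /\
                          char_poly A = \prod_(a <- s) ('X - a%:P)].

Definition level_density (R : realType) (d : measure_display)
    (T : measurableType d) (P : probability T R) (N : nat)
    (h : 'I_N -> 'I_N -> {RV P >-> R})
    (rho : {measure set (measurableTypeR R) -> \bar R}) : Prop :=
  forall f : R -> R, continuous f -> compact (closure [set x | f x != 0]) ->
    (\int[rho]_x (f x)%:E =
       \sum_(i < N) 'E_P[fun t => f (tnth (spectrum (random_matrix h t)) i)])%E.

Definition moment (R : realType) (k : nat)
    (mu : set (measurableTypeR R) -> \bar R) : R :=
  fine (\int[mu]_x ((x : R) ^+ k)%:E)%E.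

(* sigma(x) = nu rho(eta x) is an identity between densities; for measures,
   the substitution y = eta x turns it into sigma(A) = (nu / eta) rho(eta A). *)
Definition normalised (R : realType)
    (rho : set (measurableTypeR R) -> \bar R) :
    set (measurableTypeR R) -> \bar R :=
  let m0 := moment 0 rho in
  let m2 := moment 2 rho in
  let eta := Num.sqrt (m2 / m0) in
  let nu := Num.sqrt (m2 / m0 ^+ 3) in
  let rescale : measurableTypeR R -> measurableTypeR R :=
    fun y : R => y / eta in
  fun A => ((nu / eta)%:E * pushforward rho rescale A)%E.

Definition rational_on (R : realType) (D : set R) (n : nat) (F : R -> R) :
    Prop :=
  exists p q : {poly R}, [/\ (size p <= n.+1)%N, (size q <= n.+1)%N &
    forall x, D x -> q.[x] != 0 /\ F x = p.[x] / q.[x]].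

(* The bandwidth is an integer, so a derivative in b refers to the closed form
   of m N b as a function of b.  How the band is cut by the corners of the matrix
   depends on whether 2b exceeds N, so the closed form has two branches, meeting
   at b = N/2.  F N is that closed form on [1, N]: it
   interpolates m N at the integers and is a rational function on each branch,
   of degree bounded independently of N.  For N large this determines F N on
   [1, N], since two rational functions of degree at most n that agree at
   2n + 1 points are equal. *)
Definition bandwidth_continuation (R : realType) (m : nat -> nat -> R)
    (F : nat -> R -> R) : Prop :=
  exists n : nat, \forall N \near \oo,
    [/\ forall b, (1 <= b <= N)%N -> F N b%:R = m N b,
        rational_on `[1, N%:R / 2] n (F N) &
        rational_on `[N%:R / 2, N%:R] n (F N)].

(* is_derive requires F to be differentiable at b. *)
Definition critical_points (R : realType) (N : nat) (F : R -> R) : set R :=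
  [set b : R | 1 < b < N%:R /\ is_derive b (1 : R) F 0].

(* Main.v *)
(** The trace of [H ^ 4] is a sum over closed walks of length 4.  By independence
    and the first four moments, the walk i, j, k, l contributes only if i = k or
    j = l, so with d_i the number of indices at distance less than b from i,
    E tr H^2 = sum d_i and E tr H^4 = 2 sum d_i^2 + sum d_i.  Hence
    m4 = N (2 sum d_i^2 + sum d_i) / (sum d_i)^2, a rational function of b on each
    of the two branches, and its derivative has the sign of a quartic in b.  On
    the second branch this quartic is negative.  On the first one it changes sign
    near sqrt(3N/2) and near 2N/5; once divided by (b - 1)^2 it becomes strictly
    concave, so it has no further root.

    The level density tests only compactly supported functions; its moments come
    from truncated powers by monotone convergence, which requires the ordered
    eigenvalues to be measurable. *)
Require Import Defs.
From mathcomp Require Import measurable_realfun zify ring lra.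
From mathcomp.real_closed Require Import complex.

Set Implicit Arguments.
Unset Strict Implicit.
Unset Printing Implicit Defensive.

Local Open Scope classical_set_scope.
Local Open Scope ring_scope.

(** * Spectrum of a real symmetric matrix *)

Lemma char_poly_similar (F : comUnitRingType) n (P A : 'M[F]_n) :
  P \in unitmx -> char_poly (invmx P *m A *m P) = char_poly A.
Proof.
move=> Pu; rewrite /char_poly /char_poly_mx !map_mxM.
have PK : map_mx polyC (invmx P) *m map_mx polyC P = 1%:M.
  by rewrite -map_mxM mulVmx// map_mx1.
have -> : 'X%:M - map_mx polyC (invmx P) *m map_mx polyC A *m map_mx polyC P =
  map_mx polyC (invmx P) *m ('X%:M - map_mx polyC A) *m map_mx polyC P.
  rewrite mulmxBr mulmxBl scalar_mxC -[X in _ = X - _]mulmxA PK.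
  by rewrite mulmx1.
rewrite !det_mulmx mulrAC -det_mulmx PK det1 mul1r//.
Qed.

Lemma exprmx_diag (F : comUnitRingType) n (P : 'M[F]_n) (D : 'rV[F]_n) k :
  P \in unitmx ->
  (invmx P *m diag_mx D *m P) ^+ k =
  invmx P *m diag_mx (map_mx (fun x => x ^+ k) D) *m P.
Proof.
move=> Pu; elim: k => [|k IH].
  have -> : map_mx (fun x => x ^+ 0) D = const_mx 1.
    by apply/matrixP => i j; rewrite !mxE expr0.
  by rewrite diag_const_mx mulmx1 mulVmx// expr0.
rewrite exprS IH [LHS]mulmxA mulmxA mulmxK//; congr (_ *m _).
rewrite -!mulmxA mulmx_diag; congr (_ *m diag_mx _).
by apply/matrixP => i j; rewrite !mxE ord1 exprS.
Qed.

(** Over [R[i]] the matrix becomes hermitian, so the spectral theorem diagonalises it with real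
    eigenvalues. The characteristic polynomial and the traces of powers are pulled back along the
    injection of [R] into [R[i]]. *)
Lemma symmetric_split (R : rcfType) n (A : 'M[R]_n) : A^T = A ->
  exists s : n.-tuple R, char_poly A = \prod_(a <- s) ('X - a%:P) /\
    forall k, \tr (A ^+ k) = \sum_(a <- s) a ^+ k.
Proof.
move=> Asym; pose f : {rmorphism R -> R[i]} := real_complex R.
have fI : injective f by move=> x y [].
pose B := map_mx f A.
have Bherm : B \is hermsymmx.
  apply: realsym_hermsym.
    apply/is_hermitianmxP; rewrite expr0 scale1r map_mx_id//.
    by rewrite /B map_trmx Asym.
  by apply/mxOverP => i j; rewrite mxE complex_real.
have := hermitian_spectral_diag_real Bherm.
have /hermitian_normalmx /orthomx_spectralP := Bherm.
set P := spectralmx B; set D := spectral_diag B => BE /mxOverP Dreal.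
have Pu : P \in unitmx by exact: spectral_unit.
pose s := [tuple complex.Re (D 0 i) | i < n].
have fs i : f (tnth s i) = D 0 i by rewrite tnth_mktuple; exact: RRe_real.
exists s; split.
  apply: (map_inj_poly fI (rmorph0 _)).
  rewrite map_char_poly -/B BE char_poly_similar// char_poly_trig ?diag_mx_trig//.
  rewrite big_tuple rmorph_prod; apply: eq_bigr => i _.
  by rewrite rmorphB/= map_polyX map_polyC/= fs mxE eqxx.
have fAk k : map_mx f (A ^+ k) = B ^+ k.
  by elim: k => [|k IH]; rewrite ?expr0 ?map_mx1// !exprS -IH [LHS]map_mxM.
move=> k; apply: fI; rewrite -trace_map_mx fAk BE exprmx_diag// mxtrace_mulC mulmxA.
rewrite mulmxV// mul1mx mxtrace_diag rmorph_sum big_tuple; apply: eq_bigr => i _.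
by rewrite mxE rmorphXn/= fs.
Qed.

(** Sorting the roots given by [symmetric_split] shows that [spectrum] never takes its default
    value. The factorisation determines the roots up to permutation, which transfers the trace
    identity. *)
Lemma spectrumP (R : realType) n (A : 'M[R]_n) : A^T = A ->
  [/\ sorted <=%R (spectrum A),
      char_poly A = \prod_(a <- spectrum A) ('X - a%:P) &
      forall k, \tr (A ^+ k) = \sum_(a <- spectrum A) a ^+ k].
Proof.
move=> /symmetric_split[s [sE tE]].
have [srt cE] : [set s : n.-tuple R | sorted <=%R s /\
    char_poly A = \prod_(a <- s) ('X - a%:P)] (spectrum A).
  apply: xgetPex; exists [tuple of sort <=%R s]; split => /=.
    exact: (sort_sorted le_total).
  by rewrite sE; apply: perm_big; rewrite perm_sym perm_sort.
split=> // k; rewrite tE; apply: perm_big; apply: prod_XsubC_eq.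
by rewrite -sE cE.
Qed.

Lemma coef_prod_XaddC_ge0 (R : realDomainType) (s : seq R) k :
  all (fun a => 0 <= a) s -> 0 <= (\prod_(a <- s) ('X + a%:P))`_k.
Proof.
elim: s k => [|a s IH] k /=; first by rewrite big_nil coef1 ler0n.
move=> /andP[a0 s0]; rewrite big_cons mulrDl coefD coefXM coefCM.
rewrite addr_ge0// ?mulr_ge0 ?IH//.
by case: ifP => // _; exact: IH.
Qed.

(** Turns a bound on the largest root into countably many sign conditions on coefficients, hence
    into a measurable event. If [x] dominates the roots, the shifted polynomial is a product of
    factors with nonnegative coefficients; conversely, a monic polynomial with nonnegative
    coefficients has no positive root, so [l - x] cannot be positive. *)
Lemma max_root_leP (R : realFieldType) (s : seq R) l x : all (fun a => a <= l) s ->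
  l \in s ->
  l <= x <-> forall k, 0 <= ((\prod_(a <- s) ('X - a%:P)) \Po ('X + x%:P))`_k.
Proof.
move=> sl ls; set q := _ \Po _.
have qE : q = \prod_(a <- [seq x - b | b <- s]) ('X + a%:P).
  rewrite /q rmorph_prod/= big_map; apply: eq_bigr => a _.
  by rewrite comp_polyB comp_polyX comp_polyC rmorphB/= addrA.
have qm : q \is monic.
  rewrite qE; under eq_bigr do rewrite -[_%:P]opprK -rmorphN.
  by rewrite -(big_map -%R predT (fun a => 'X - a%:P)) monic_prod_XsubC.
have ql : q.[l - x] = 0.
  by rewrite horner_comp !hornerE subrK; apply/rootP; rewrite root_prod_XsubC.
split=> [lx k|q0].
  rewrite qE coef_prod_XaddC_ge0// all_map; apply/allP => a /(allP sl)/= al.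
  by rewrite subr_ge0 (le_trans al).
rewrite leNgt; apply/negP; rewrite -subr_gt0 => y0.
have : 0 < q.[l - x].
  have := monicP qm; rewrite lead_coefE => lq.
  rewrite horner_coef (polySpred (monic_neq0 qm)) big_ord_recr/= lq mul1r.
  rewrite ltr_wpDl ?exprn_gt0//; apply: sumr_ge0 => i _.
  by rewrite mulr_ge0// exprn_ge0// ltW.
by rewrite ql ltxx.
Qed.

(** * Measurability of the ordered eigenvalues *)

Section measurable_coefficients.
Context d (T : measurableType d) (R : realType).

Definition coef_measurable (p : T -> {poly R}) :=
  forall k, measurable_fun setT (fun t => (p t)`_k).

Lemma coef_measurable_cst p : coef_measurable (fun=> p).
Proof. by move=> k; exact: measurable_cst. Qed.

Lemma coef_measurableM p q : coef_measurable p -> coef_measurable q ->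
  coef_measurable (fun t => p t * q t).
Proof.
move=> mp mq k; under eq_fun do rewrite coefM.
by apply: measurable_sum => i; exact: measurable_funM.
Qed.

Lemma coef_measurable_prod (I : Type) (s : seq I) (P : pred I)
    (p : I -> T -> {poly R}) : (forall i, coef_measurable (p i)) ->
  coef_measurable (fun t => \prod_(i <- s | P i) p i t).
Proof.
move=> mp; elim: s => [|i s IH].
  by under eq_fun do rewrite big_nil; exact: coef_measurable_cst.
have [Pi|Pi] := boolP (P i).
  by under eq_fun do rewrite big_cons Pi; exact: coef_measurableM.
by under eq_fun do rewrite big_cons (negbTE Pi).
Qed.

Lemma coef_measurable_char_poly n (A : T -> 'M[R]_n) :
  (forall i j, measurable_fun setT (fun t => A t i j)) ->
  coef_measurable (fun t => char_poly (A t)).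
Proof.
move=> mA k; under eq_fun do rewrite /char_poly /determinant coef_sum.
apply: measurable_sum => s; apply: coef_measurableM.
  exact: coef_measurable_cst.
apply: coef_measurable_prod => i k'.
under eq_fun do rewrite !mxE coefB coefC.
apply: measurable_funB; first exact: measurable_cst.
by case: eqP => _; [exact: mA|exact: measurable_cst].
Qed.

(* Induction on the number of roots: the largest one is measurable by
   [max_root_leP], and dividing it out keeps the coefficients measurable. *)
Lemma measurable_sorted_roots n (s : T -> seq R) :
  (forall t, size (s t) = n) -> (forall t, sorted <=%R (s t)) ->
  coef_measurable (fun t => \prod_(a <- s t) ('X - a%:P)) ->
  forall i, measurable_fun setT (fun t => (s t)`_i).
Proof.
elim: n s => [|n IH] s sz srt ms i.
  have -> : (fun t => (s t)`_i) = cst 0; last exact: measurable_cst.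
  by apply: funext => t; rewrite nth_default// sz.
pose p t := \prod_(a <- s t) ('X - a%:P).
pose l t := (s t)`_n; pose s' t := take n (s t).
have sE t : s t = rcons (s' t) (l t).
  by rewrite -take_nth ?sz// take_oversize ?sz.
have szs' t : size (s' t) = n by rewrite size_take sz ltnSn.
have all_le t : all (fun a => a <= l t) (s t).
  have := srt t; rewrite (sorted_pairwise le_trans) sE pairwise_rcons => /andP[le_l _].
  by rewrite all_rcons lexx.
have l_in t : l t \in s t by rewrite mem_nth// sz.
have ml : measurable_fun setT l.
  move=> _; apply: (measurability _ (RGenOInfty.measurableE R)) => //.
  move=> _ [_ [x ->] <-]; rewrite setTI.
  have -> : l @^-1` `]x, +oo[ =
      ~` \bigcap_k [set t | 0 <= (p t \Po ('X + x%:P))`_k].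
    apply/seteqP; split=> t /=; rewrite in_itv/= andbT ltNge.
      move=> /negP xl pk; apply: xl.
      by apply/(max_root_leP x (all_le t) (l_in t)) => k; exact: pk.
    move=> pk; apply/negP => lx; apply: pk => k _ /=.
    by apply: (max_root_leP x (all_le t) (l_in t)).1.
  apply: measurableC; apply: bigcapT_measurable => k.
  rewrite -[X in measurable X]setTI.
  have mpk : measurable_fun setT (fun t => (p t \Po ('X + x%:P))`_k).
    under eq_fun do rewrite coef_comp_poly size_prod_XsubC sz.
    by apply: measurable_sum => j; apply: measurable_funM.
  by have := mpk measurableT _ (measurable_itv `[0, +oo[); rewrite preimage_itvcy.
pose p' t := \prod_(a <- s' t) ('X - a%:P).
have pE t : p t = p' t * ('X - (l t)%:P).
  by rewrite /p sE -cats1 big_cat big_seq1.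
have mp' : coef_measurable p'.
  (* The coefficients of the quotient are recovered from the top down: those of index above [n]
     vanish, and the one of index [k] is that of [p] at [k.+1] plus [l] times that of [p'] at
     [k.+1]. *)
  have coefs m k : (n < k + m)%N -> measurable_fun setT (fun t => (p' t)`_k).
    elim: m k => [|m IHm] k nk.
      have -> : (fun t => (p' t)`_k) = cst 0; last exact: measurable_cst.
      apply: funext => t; rewrite nth_default// size_prod_XsubC szs'.
      by rewrite addn0 in nk.
    have -> : (fun t => (p' t)`_k) = (fun t => (p t)`_k.+1 + l t * (p' t)`_k.+1).
      apply: funext => t; rewrite pE mulrBr coefB coefMX coefMC/=.
      by rewrite [l t * _]mulrC subrK.
    apply: measurable_funD; first exact: ms.
    by apply: measurable_funM; [exact: ml|apply: IHm; rewrite addSnnS].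
  by move=> k; apply: (coefs n.+1); rewrite leq_addl.
have ms' := IH s' szs' _ mp'.
under eq_fun do rewrite sE nth_rcons szs'.
have [_|_] := ltnP i n; first apply: ms' => t.
  by have := srt t; rewrite !(sorted_pairwise le_trans) sE pairwise_rcons => /andP[].
by case: eqP => _ //; exact: measurable_cst.
Qed.

Lemma measurable_spectrum n (A : T -> 'M[R]_n) :
  (forall t, (A t)^T = A t) ->
  (forall i j, measurable_fun setT (fun t => A t i j)) ->
  forall i, measurable_fun setT (fun t => tnth (spectrum (A t)) i).
Proof.
move=> symA mA i; under eq_fun do rewrite (tnth_nth 0).
apply: (@measurable_sorted_roots n (fun t => spectrum (A t))).
- by move=> t; rewrite size_tuple.
- by move=> t; case: (spectrumP (symA t)).
- have -> : (fun t => \prod_(a <- spectrum (A t)) ('X - a%:P)) =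
      (fun t => char_poly (A t)).
    by apply: funext => t; case: (spectrumP (symA t)).
  exact: coef_measurable_char_poly.
Qed.

End measurable_coefficients.

(** * Independence *)

Section factorisation.
Context d (T : measurableType d) (R : realType) (P : probability T R).
Variables (X Z : T -> R).
Hypotheses (mX : measurable_fun setT X) (mZ : measurable_fun setT Z).
Hypothesis Z0 : forall t, 0 <= Z t.
Hypothesis Zfin : (\int[P]_t (Z t)%:E \is a fin_num)%E.
Hypothesis XZ : forall B : set R, measurable B ->
  (\int[P]_t (\1_B (X t) * Z t)%:E =
   \int[P]_t (\1_B (X t))%:E * \int[P]_t (Z t)%:E)%E.

Import HBNNSimple.

Let nnsfun_factor (g : {nnsfun R >-> R}) :
  (\int[P]_t (g (X t) * Z t)%:E = \int[P]_t (g (X t))%:E * \int[P]_t (Z t)%:E)%E.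
Proof.
have mB k : measurable (g @^-1` [set k]).
  by rewrite -[_ @^-1` _]setTI; exact: measurable_funP.
have m1 k : measurable_fun setT (fun t => \1_(g @^-1` [set k]) (X t) : R).
  exact: (measurableT_comp (measurable_indic (mB k)) mX).
(* A negative [k] is not a value of [g], so its level set is empty. *)
have ge0 k t : 0 <= k * \1_(g @^-1` [set k]) (X t).
  have [k0|k0] := leP 0 k; first by rewrite mulr_ge0.
  by rewrite preimage_nnfun0// indic0 mulr0.
pose s : seq R := finmap.enum_fset (fset_set (range g)).
have gE x : g x = \sum_(k <- s) k * \1_(g @^-1` [set k]) x.
  by rewrite [LHS]fimfunE fsbig_finite.
transitivity (\sum_(k <- s) \int[P]_t (k * \1_(g @^-1` [set k]) (X t) * Z t)%:E)%E.
  rewrite -ge0_integral_sum//.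
  - by apply: eq_integral => t _; rewrite gE mulr_suml sumEFin.
  - by move=> k; apply/measurable_EFinP; do 2 apply: measurable_funM => //.
  - by move=> k t _; rewrite lee_fin mulr_ge0.
transitivity ((\sum_(k <- s) \int[P]_t (k * \1_(g @^-1` [set k]) (X t))%:E) *
    \int[P]_t (Z t)%:E)%E; last first.
  congr (_ * _)%E; rewrite -ge0_integral_sum//.
  - by apply: eq_integral => t _; rewrite gE sumEFin.
  - by move=> k; apply/measurable_EFinP; apply: measurable_funM => //.
  - by move=> k t _; rewrite lee_fin.
rewrite ge0_sume_distrl; last by move=> k _; apply: integral_ge0 => t _; rewrite lee_fin.
apply: eq_bigr => k _.
have [k0|k0] := leP 0 k; last first.
  rewrite preimage_nnfun0//; under eq_integral do rewrite indic0 mulr0 mul0r.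
  by under [in RHS]eq_integral do rewrite indic0 mulr0; rewrite integral0 mul0e.
under eq_integral do rewrite -mulrA EFinM.
rewrite ge0_integralZl//; first last.
- by move=> t _; rewrite lee_fin mulr_ge0.
- by apply/measurable_EFinP; exact: measurable_funM.
rewrite XZ// muleA; congr (_ * _)%E.
under [in RHS]eq_integral do rewrite EFinM.
rewrite ge0_integralZl//.
- exact/measurable_EFinP.
Qed.

(** The hypothesis [XZ] is the case of indicators. Linearity extends it to simple functions in
    [nnsfun_factor], and monotone convergence on both sides to [f]; finiteness of the integral of
    [Z] lets the limit pass through the product. *)
Lemma ge0_integral_factor (f : R -> R) : measurable_fun setT f ->
  (forall x, 0 <= f x) ->
  (\int[P]_t (f (X t) * Z t)%:E = \int[P]_t (f (X t))%:E * \int[P]_t (Z t)%:E)%E.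
Proof.
move=> mf f0.
have mEf : measurable_fun setT (EFin \o f) by exact/measurable_EFinP.
pose g := nnsfun_approx measurableT mEf.
have gf x : (g n x)%:E @[n --> \oo] --> (f x)%:E.
  by apply: (cvg_nnsfun_approx measurableT mEf) => // y _; rewrite lee_fin.
have ndg x m n : (m <= n)%N -> g m x <= g n x.
  by move=> mn; have /lefP := nd_nnsfun_approx measurableT mEf mn; exact.
have mg n : measurable_fun setT (fun t => g n (X t)).
  exact: (measurableT_comp (measurable_funP (g n)) mX).
have cvg1 : (\int[P]_t (g n (X t))%:E @[n --> \oo] -->
             \int[P]_t (f (X t))%:E)%E.
  have -> : (\int[P]_t (f (X t))%:E =
             \int[P]_t (limn (fun n => (g n (X t))%:E)))%E.
    by apply: eq_integral => t _; exact/esym/cvg_lim.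
  apply: cvg_monotone_convergence => //.
  - by move=> n; exact/measurable_EFinP.
  - by move=> n t _; rewrite lee_fin.
  - by move=> t _ m n mn; rewrite lee_fin ndg.
have cvg2 : (\int[P]_t (g n (X t) * Z t)%:E @[n --> \oo] -->
             \int[P]_t (f (X t) * Z t)%:E)%E.
  have -> : (\int[P]_t (f (X t) * Z t)%:E =
             \int[P]_t (limn (fun n => (g n (X t) * Z t)%:E)))%E.
    apply: eq_integral => t _; apply/esym/cvg_lim => //.
    under eq_fun do rewrite EFinM; rewrite EFinM.
    by apply: cvgeZr => //.
  apply: cvg_monotone_convergence => //.
  - by move=> n; apply/measurable_EFinP; exact: measurable_funM.
  - by move=> n t _; rewrite lee_fin mulr_ge0.
  - by move=> t _ m n mn; rewrite lee_fin ler_wpM2r// ndg.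
apply: (cvg_unique _ cvg2) => //.
rewrite (_ : (fun n => _) =
    (fun n => \int[P]_t (g n (X t))%:E * \int[P]_t (Z t)%:E)%E); last first.
  by apply: funext => n; exact: nnsfun_factor.
by apply: cvgeZr.
Qed.

End factorisation.

(** * Expectations of products of independent variables *)

Section independent_product.
Context (R : realType) (d : measure_display) (T : measurableType d).
Context (P : probability T R) (I : finType) (D J : {set I}).
Variable X : I -> {RV P >-> R}.
Hypotheses (indX : mutually_independent D X) (JD : J \subset D).
Implicit Types f : I -> R -> R.

Let update f e (g : R -> R) e' := if e' == e then g else f e'.

Lemma ge0_independent_prod f :
  (forall e, measurable_fun setT (f e)) -> (forall e x, 0 <= f e x) ->
  (forall e, e \in J -> (\int[P]_t (f e (X e t))%:E \is a fin_num)%E) ->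
  (\int[P]_t (\prod_(e in J) f e (X e t))%:E =
   \prod_(e in J) \int[P]_t (f e (X e t))%:E)%E.
Proof.
have mX e : measurable_fun setT (X e) by exact: measurable_funP.
(* The list [s] holds the indices whose factor is arbitrary; off [s] the factors are indicators. For
   empty [s] this is the definition of independence, and each induction step frees one index. *)
suff base (s : seq I) (g : I -> R -> R) :
    (forall e, measurable_fun setT (g e)) -> (forall e x, 0 <= g e x) ->
    (forall e, e \in J -> (\int[P]_t (g e (X e t))%:E \is a fin_num)%E) ->
    (forall e, e \in J -> e \notin s -> exists2 B, measurable B & g e = \1_B) ->
    (\int[P]_t (\prod_(e in J) g e (X e t))%:E =
     \prod_(e in J) \int[P]_t (g e (X e t))%:E)%E.
  move=> mf f0 ffin; apply: (base (enum I)) => // e _.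
  by rewrite mem_enum.
elim: s g => [|e0 s IH] g mg g0 gfin gind.
  have /choice[B BP] : forall e, exists B : set R,
      measurable B /\ (e \in J -> g e = \1_B).
    move=> e; have [eJ|eJ] := boolP (e \in J); last by exists setT.
    by have [B mB gB] := gind e eJ isT; exists B.
  have mB e : measurable (X e @^-1` B e).
    by rewrite -[_ @^-1` _]setTI; apply: mX => //; exact: (BP e).1.
  pose A := \bigcap_(e in [set` J]) (X e @^-1` B e).
  have mA : measurable A.
    by apply: fin_bigcap_measurable => //; exact: finite_set_mem.
  transitivity (P A).
    transitivity (\int[P]_t (\1_A t)%:E)%E; last by rewrite integral_indic// setIT.
    apply: eq_integral => t _; congr (_%:E); rewrite indicE.
    have [tA|tA] := boolP (t \in A).
      rewrite big1// => e eJ; rewrite (BP e).2// indicE mem_set//.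
      by move: tA; rewrite inE => /(_ e eJ).
    have [e eJ teB] : exists2 e, e \in J & ~ B e (X e t).
      apply: contrapT => H; move/negP: tA; apply; rewrite inE => e eJ.
      by apply: contrapT => teB; apply: H; exists e.
    by rewrite (bigD1 e)//= (BP e).2// indicE memNset// mul0r.
  rewrite (indX JD (fun e => (BP e).1)); apply: eq_bigr => e eJ.
  rewrite (BP e).2// (_ : (fun t => _) = (fun t => (\1_(X e @^-1` B e) t)%:E))//.
  by rewrite integral_indic// setIT.
have [e0J|e0J] := boolP (e0 \in J); last first.
  apply: IH => // e eJ es; apply: gind => //; rewrite inE negb_or es andbT.
  by apply: contraNneq e0J => <-.
pose Z t := \prod_(e in J | e != e0) g e (X e t).
pose W := (\prod_(e in J | e != e0) \int[P]_t (g e (X e t))%:E)%E.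
(* An indicator at [e0] brings the product under the induction hypothesis; this is the hypothesis on
   indicators of [ge0_integral_factor]. *)
have IHB B : measurable B ->
    (\int[P]_t (\1_B (X e0 t) * Z t)%:E = \int[P]_t (\1_B (X e0 t))%:E * W)%E.
  move=> mB.
  have eqZ t : \1_B (X e0 t) * Z t = \prod_(e in J) update g e0 \1_B e (X e t).
    rewrite [RHS](bigD1 e0)//= /update eqxx; congr (_ * _).
    by apply: eq_bigr => e /andP[_ /negbTE ->].
  under eq_integral do rewrite eqZ.
  rewrite IH.
  - rewrite (bigD1 e0)//= /update eqxx; congr (_ * _)%E.
    by apply: eq_bigr => e /andP[_ /negbTE ->].
  - move=> e; rewrite /update; case: ifP => // _; exact: measurable_indic.
  - by move=> e x; rewrite /update; case: ifP.
  - move=> e eJ; rewrite /update; case: ifP => [_|_]; last exact: gfin.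
    rewrite (_ : (fun t => _) = (fun t => (\1_(X e @^-1` B) t)%:E))//.
    rewrite integral_indic//; last by rewrite -[X in measurable X]setTI; exact: mX.
    by rewrite setIT fin_num_measure//; rewrite -[X in measurable X]setTI; exact: mX.
  - move=> e eJ es; rewrite /update; case: ifPn => [_|ee0]; first by exists B.
    by apply: gind => //; rewrite inE negb_or ee0.
have ZW : (\int[P]_t (Z t)%:E = W)%E.
  have := IHB setT measurableT; under eq_integral do rewrite indicT mul1r.
  rewrite (_ : \int[P]_t (\1_setT (X e0 t))%:E = 1)%E ?mul1e//.
  rewrite indicT; transitivity (\int[P]_t (cst 1 t))%E => //.
  by rewrite integral_cst// mul1e; exact: probability_setT.
transitivity (\int[P]_t (g e0 (X e0 t) * Z t)%:E)%E.
  by apply: eq_integral => t _; rewrite (bigD1 e0).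
rewrite (@ge0_integral_factor _ _ _ P) //.
- by rewrite ZW [RHS](bigD1 e0).
- rewrite /Z; under eq_fun do rewrite -big_filter_cond -big_filter.
  by apply: measurable_prod => e _; exact: measurableT_comp.
- by move=> t; apply: prodr_ge0.
- by rewrite ZW; apply: prode_fin_num => e /andP[eJ _]; exact: gfin.
- by move=> B mB; rewrite ZW IHB.
Qed.

(** The absolute value of the product is a product of functions of the same independent variables,
    so [ge0_independent_prod] makes its integral a finite product of finite factors. *)
Lemma integrable_independent_prod f :
  (forall e, measurable_fun setT (f e)) ->
  (forall e, e \in J -> P.-integrable setT (fun t => (f e (X e t))%:E)) ->
  P.-integrable setT (fun t => (\prod_(e in J) f e (X e t))%:E).
Proof.
move=> mf intf; apply/integrableP; split.
  apply/measurable_EFinP; under eq_fun do rewrite -big_filter.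
  by apply: measurable_prod => e _; exact: measurableT_comp.
under eq_integral do rewrite abse_EFin normr_prod.
have fin e : e \in J -> (\int[P]_t `|f e (X e t)|%:E \is a fin_num)%E.
  move=> eJ; apply: integrable_fin_num => //.
  by rewrite (_ : (fun t => _) = abse \o (fun t => (f e (X e t))%:E))//;
    apply: integrable_abse => //; exact: intf.
rewrite (@ge0_independent_prod (fun e x => `|f e x|)) ?ltey_eq ?prode_fin_num//.
by move=> e; exact: measurableT_comp.
Qed.

Lemma independent_prod f :
  (forall e, measurable_fun setT (f e)) ->
  (forall e, e \in J -> P.-integrable setT (fun t => (f e (X e t))%:E)) ->
  (\int[P]_t (\prod_(e in J) f e (X e t))%:E =
   \prod_(e in J) \int[P]_t (f e (X e t))%:E)%E.
Proof.
(* Here [s] holds the indices whose factor may change sign. Freeing an index splits its factor into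
   positive and negative parts, each covered by the induction hypothesis. *)
suff base (s : seq I) (g : I -> R -> R) :
    (forall e, measurable_fun setT (g e)) ->
    (forall e, e \in J -> P.-integrable setT (fun t => (g e (X e t))%:E)) ->
    (forall e x, e \notin s -> 0 <= g e x) ->
    (\int[P]_t (\prod_(e in J) g e (X e t))%:E =
     \prod_(e in J) \int[P]_t (g e (X e t))%:E)%E.
  move=> mf intf; apply: (base (enum I)) => // e x.
  by rewrite mem_enum.
elim: s g => [|e0 s IH] g mg intg g0.
  apply: ge0_independent_prod => // [e x|e eJ]; first exact: g0.
  by apply: integrable_fin_num => //; exact: intg.
have [e0J|e0J] := boolP (e0 \in J); last first.
  (* An index off [J] does not occur in the product, so its function may be replaced by 0 to meet
     the sign condition of [IH]. *)
  have gE : forall e, e \in J -> g e = update g e0 (cst 0) e.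
    by move=> e eJ; rewrite /update; case: eqP => // ee0; rewrite -ee0 eJ in e0J.
  under eq_integral do under eq_bigr => e eJ do rewrite gE//.
  under [RHS]eq_bigr => e eJ do rewrite gE//.
  apply: IH => [e|e eJ|e x es]; rewrite /update.
  - by case: ifP => // _; exact: measurable_cst.
  - by rewrite -/(update _ _ _ _) -gE//; exact: intg.
  - by case: ifPn => // ee0; apply: g0; rewrite inE negb_or ee0.
pose W := (\prod_(e in J | e != e0) \int[P]_t (g e (X e t))%:E)%E.
have Wfin : W \is a fin_num.
  by apply: prode_fin_num => e /andP[eJ _]; apply: integrable_fin_num => //; exact: intg.
have part (v : R -> R) : measurable_fun setT v -> (forall x, 0 <= v x) ->
    P.-integrable setT (fun t => (v (X e0 t))%:E) ->
    P.-integrable setT (fun t => (v (X e0 t) *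
      \prod_(e in J | e != e0) g e (X e t))%:E) /\
    (\int[P]_t (v (X e0 t) * \prod_(e in J | e != e0) g e (X e t))%:E =
     \int[P]_t (v (X e0 t))%:E * W)%E.
  move=> mv v0 intv.
  have mu e : measurable_fun setT (update g e0 v e) by rewrite /update; case: ifP.
  have intu e : e \in J ->
      P.-integrable setT (fun t => (update g e0 v e (X e t))%:E).
    by rewrite /update; case: ifPn => [/eqP ->|_] // /intg.
  have eqp t : v (X e0 t) * \prod_(e in J | e != e0) g e (X e t) =
      \prod_(e in J) update g e0 v e (X e t).
    rewrite [RHS](bigD1 e0)//= /update eqxx; congr (_ * _).
    by apply: eq_bigr => e /andP[_ /negbTE ->].
  split.
    by under eq_fun do rewrite eqp; exact: integrable_independent_prod.
  under eq_integral do rewrite eqp.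
  rewrite IH//; last first.
    by move=> e x es; rewrite /update; case: ifPn => // ee0; rewrite g0// inE negb_or ee0.
  rewrite (bigD1 e0)//= /update eqxx; congr (_ * _)%E.
  by apply: eq_bigr => e /andP[_ /negbTE ->].
pose gp x := Num.max (g e0 x) 0; pose gm x := Num.max (- g e0 x) 0.
have gE x : g e0 x = gp x - gm x.
  rewrite /gp /gm; have [h|h] := leP 0 (g e0 x).
    by rewrite max_r ?oppr_le0// subr0.
  by rewrite max_l ?sub0r ?opprK// oppr_ge0 ltW.
have intgp : P.-integrable setT (fun t => (gp (X e0 t))%:E).
  exact: (integrable_funrpos measurableT (intg _ e0J)).
have intgm : P.-integrable setT (fun t => (gm (X e0 t))%:E).
  exact: (integrable_funrneg measurableT (intg _ e0J)).
have [] := part gp (measurable_maxr (mg e0) (measurable_cst _)) _ intgp.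
  by move=> x; rewrite le_max lexx orbT.
move=> iP EP.
have [] := part gm (measurable_maxr (measurable_funN (mg e0)) (measurable_cst _)) _ intgm.
  by move=> x; rewrite le_max lexx orbT.
move=> iM EM.
rewrite [RHS](bigD1 e0)//= -/W.
under eq_integral do rewrite (bigD1 e0)//= gE mulrBl EFinB.
rewrite integralB// EP EM.
under [X in (_ = X * _)%E]eq_integral do rewrite gE EFinB.
rewrite integralB// [RHS]muleBl//.
by apply: fin_num_adde_defr; exact: integrable_fin_num.
Qed.

End independent_product.

(** * Expected traces *)

Definition in_band (N b : nat) (i j : 'I_N) : bool := (`|i - j| < b)%N.

Definition band_degree (R : pzSemiRingType) (N b : nat) (i : 'I_N) : R :=
  \sum_(j < N) (in_band b i j)%:R.

Lemma in_bandC N b (i j : 'I_N) : in_band b i j = in_band b j i.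
Proof. by rewrite /in_band distnC. Qed.

(** Representative of an unordered pair: by symmetry [h i j] equals the entry at [upper i j], which
    lies in the index set of the independence hypothesis. *)
Definition upper (N : nat) (i j : 'I_N) : 'I_N * 'I_N :=
  if (i <= j)%N then (i, j) else (j, i).

Lemma upper_eq N (i j k l : 'I_N) :
  (upper i j == upper k l) = (i == k) && (j == l) || (i == l) && (j == k).
Proof.
have eqv (x y : 'I_N) : (x == y) = (x == y :> nat) by [].
rewrite /upper !eqv; case: leqP => ij; case: leqP => kl; rewrite xpair_eqE !eqv; lia.
Qed.

Lemma upperC N (i j : 'I_N) : upper i j = upper j i.
Proof. by apply/eqP; rewrite upper_eq !eqxx orbT. Qed.

Lemma upper_le N (i j : 'I_N) : ((upper i j).1 <= (upper i j).2)%N.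
Proof. by rewrite /upper; case: (leqP i j) => //= /ltnW. Qed.

(** Groups the repeated edges of a walk, so that independence applies to powers of distinct
    entries. *)
Lemma prod_count (R : comPzRingType) (I : finType) (D : {set I}) (s : seq I) (x : I -> R) :
  all [in D] s -> \prod_(e <- s) x e = \prod_(e in D) x e ^+ count_mem e s.
Proof.
elim: s => [_|e0 s IH /= /andP[e0D sD]]; first by rewrite big_nil big1.
rewrite big_cons IH//; under [RHS]eq_bigr do rewrite exprD.
rewrite big_split/=; congr (_ * _); rewrite (bigD1 e0)//= eqxx expr1 big1 ?mulr1//.
by move=> e /andP[_]; rewrite eq_sym => /negbTE ->; rewrite expr0.
Qed.

Section band_moments.
Context (R : realType) (d : measure_display) (T : measurableType d).
Context (P : probability T R) (N b : nat).
Variable h : 'I_N -> 'I_N -> {RV P >-> R}.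
Hypotheses (hB : banded_wigner b h) (h4 : four_moment b h).

(* Meaningful for [k <= 4] only. *)
Definition entry_moment (inside : bool) (k : nat) : R :=
  if inside then nth 0 [:: 1; 0; 1; 0; 3] k else (k == 0)%:R.

(** Inside the band the fourth moment is 3, hence finite, and [1 + x ^+ 4] dominates the lower
    powers of [x]. Outside, the entry is 0. *)
Lemma entry_integrable i j k : (k <= 4)%N ->
  P.-integrable setT (fun t => (h i j t ^+ k)%:E).
Proof.
move=> k4; have [ij|ij] := boolP (in_band b i j); last first.
  have [_ _ _ /(_ i j)] := hB; rewrite leqNgt => /(_ ij) h0.
  by under eq_fun do rewrite h0; exact: finite_measure_integrable_cst.
have int4 : P.-integrable setT (fun t => (h i j t ^+ 4)%:E).
  apply/integrableP; split; first exact/measurable_EFinP/measurable_funX.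
  have [_] := h4 ij; rewrite unlock.
  under [in X in _ -> X]eq_integral do rewrite abse_EFin ger0_norm ?exprn_even_ge0//.
  by move=> ->; rewrite ltry.
apply: (@le_integrable _ _ _ _ _ measurableT _ (fun t => (1 + h i j t ^+ 4)%:E)).
- exact/measurable_EFinP/measurable_funX.
- move=> t _; rewrite lee_fin normrX (ger0_norm (x := 1 + _)); last first.
    by rewrite addr_ge0// exprn_even_ge0.
  rewrite -[h i j t ^+ 4]ger0_norm ?exprn_even_ge0// normrX.
  set x := `|_|; have x0 : 0 <= x by exact: normr_ge0.
  have [x1|x1] := leP x 1.
    by rewrite ler_wpDr ?exprn_ge0// exprn_ile1.
  by rewrite ler_wpDl// ler_weXn2l// ltW.
- under eq_fun do rewrite EFinD.
  by apply: integrableD => //; exact: finite_measure_integrable_cst.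
Qed.

Lemma entry_momentE i j k : (k <= 4)%N ->
  (\int[P]_t (h i j t ^+ k)%:E = (entry_moment (in_band b i j) k)%:E)%E.
Proof.
move=> k4; rewrite /entry_moment.
have int1 : (\int[P]_t 1%:E = 1)%E.
  by rewrite integral_cst// mul1e; exact: probability_setT.
have [ij|ij] := boolP (in_band b i j); last first.
  have [_ _ _ /(_ i j)] := hB; rewrite leqNgt => /(_ ij) h0.
  under eq_integral do rewrite h0 expr0n.
  by case: k {k4} => [|k] //=; rewrite integral0.
have [_ _ /(_ i j ij)[h1 h2] _] := hB; have [h3 h4'] := h4 ij.
rewrite unlock in h1 h2 h3 h4'.
case: k k4 => [|[|[|[|[|//]]]]] _ //=.
Qed.

Let X (e : 'I_N * 'I_N) := h e.1 e.2.
Let D : {set 'I_N * 'I_N} := [set ij : 'I_N * 'I_N | (ij.1 <= ij.2)%N]%SET.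

Let XE i j t : h i j t = X (upper i j) t.
Proof. by rewrite /X /upper; case: ifP => //= _; have [->] := hB. Qed.

(** The bound 4 on the length keeps every multiplicity within the range of [entry_moment]. *)
Lemma expectation_entries (s : seq ('I_N * 'I_N)) : (size s <= 4)%N ->
  all [in D] s ->
  P.-integrable setT (fun t => (\prod_(e <- s) X e t)%:E) /\
  (\int[P]_t (\prod_(e <- s) X e t)%:E =
   (\prod_(e in D) entry_moment (in_band b e.1 e.2) (count_mem e s))%:E)%E.
Proof.
move=> s4 sD; have [_ ind _ _] := hB.
have cnt e : (count_mem e s <= 4)%N by rewrite (leq_trans (count_size _ _)).
have mX e : measurable_fun setT (fun x : R => x ^+ count_mem e s).
  exact: measurable_funX.
have intX e : e \in D -> P.-integrable setT (fun t => (X e t ^+ count_mem e s)%:E).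
  by move=> _; exact: entry_integrable.
split.
  under eq_fun do rewrite (prod_count _ sD).
  exact: (@integrable_independent_prod _ _ _ _ _ D D _ ind _ _ mX).
under eq_integral do rewrite (prod_count _ sD).
rewrite (@independent_prod _ _ _ _ _ D D _ ind _ _ mX)//.
rewrite -prodEFin; apply: eq_bigr => e _; exact: entry_momentE.
Qed.

Let upperD (i j : 'I_N) : upper i j \in D.
Proof. by rewrite inE upper_le. Qed.

Let band_upper (i j : 'I_N) : in_band b (upper i j).1 (upper i j).2 = in_band b i j.
Proof. by rewrite /upper; case: ifP => //= _; rewrite in_bandC. Qed.

Let entry_moment0 a : entry_moment a 0 = 1.
Proof. by case: a. Qed.

Let entry_moment1 a : entry_moment a 1 = 0.
Proof. by case: a. Qed.

(** If [i = k] or [j = l], the walk runs twice through each of two edges; otherwise some edge occurs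
    exactly once and the mean is 0. When both equalities hold, the two edges coincide, and the last
    summand completes 1 + 1 to the fourth moment 3. *)
Lemma expectation_closed_walk4 i j k l :
  P.-integrable setT (fun t => (h i j t * h j k t * h k l t * h l i t)%:E) /\
  (\int[P]_t (h i j t * h j k t * h k l t * h l i t)%:E =
   ((i == k)%:R * ((in_band b i j)%:R * (in_band b i l)%:R) +
    (j == l)%:R * ((in_band b i j)%:R * (in_band b j k)%:R) +
    ((i == k) && (j == l))%:R * (in_band b i j)%:R)%:E)%E.
Proof.
pose s := [:: upper i j; upper j k; upper k l; upper l i].
have sE t : h i j t * h j k t * h k l t * h l i t = \prod_(e <- s) X e t.
  by rewrite !big_cons big_nil -!XE mulr1 !mulrA.
under eq_fun do rewrite sE.
have [|ints ->] := @expectation_entries s isT; first by rewrite /= !upperD.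
split=> //; congr (_%:E).
have two a c : a \in D -> c \in D -> (forall e, count_mem e s =
    (e == a).*2 + (e == c).*2)%N -> \prod_(e in D)
    entry_moment (in_band b e.1 e.2) (count_mem e s) =
    if a == c then 3 * (in_band b a.1 a.2)%:R
    else (in_band b a.1 a.2)%:R * (in_band b c.1 c.2)%:R.
  move=> aD cD cnt; rewrite (bigD1 a)// cnt eqxx.
  have [ac|ac] := eqVneq a c.
    rewrite big1 ?mulr1 => [|e /andP[_ /negbTE ea]]; last by rewrite cnt -ac ea entry_moment0.
    by rewrite /entry_moment; case: ifP => _ /=; rewrite ?mulr1 ?mulr0.
  rewrite (bigD1 c) ?cD 1?eq_sym// cnt eqxx [c == a]eq_sym (negbTE ac).
  rewrite big1 => [|e /andP[/andP[_ /negbTE ea] /negbTE ec]]; last first.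
    by rewrite cnt ea ec entry_moment0.
  by rewrite /= mulr1 /entry_moment; do 2 (case: ifP => _ /=); rewrite ?mulr1 ?mulr0 ?mul0r.
have eqv (x y : 'I_N) : (x == y) = (x == y :> nat) by [].
have [ik|ik] := eqVneq i k.
  rewrite -ik in s sE ints two *.
  rewrite (two (upper i j) (upper i l)) ?upperD//; last first.
    move=> e; rewrite /= (upperC j i) (upperC l i) !(eq_sym e); lia.
  have -> : (upper i j == upper i l) = (j == l) by rewrite upper_eq !eqv; lia.
  rewrite !band_upper mul1r /=; have [->|_] := eqVneq j l.
    by rewrite (in_bandC b l i); case: in_band => /=; ring.
  by rewrite !mul0r !addr0.
rewrite mul0r add0r /= mul0r addr0.
have [jl|jl] := eqVneq j l.
  rewrite -jl in s sE ints two *.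
  rewrite (two (upper i j) (upper j k)) ?upperD//; last first.
    move=> e; rewrite /= (upperC k j) (upperC j i) !(eq_sym e); lia.
  have -> : (upper i j == upper j k) = false.
    by move: ik; rewrite upper_eq !eqv; lia.
  by rewrite !band_upper mul1r.
rewrite mul0r.
have zero e : count_mem e s = 1%N -> \prod_(e in D)
    entry_moment (in_band b e.1 e.2) (count_mem e s) = 0.
  move=> cnt; have eD : e \in D.
    have : e \in s by rewrite -has_pred1 has_count cnt.
    by rewrite !inE => /or4P[] /eqP ->; rewrite upper_le.
  by rewrite (bigD1 e)// cnt entry_moment1 /= mul0r.
(* If these edges agree, then [l = i] and [k = j]: the walk is i, j, j, i, and its loop at [j]
   occurs once. Otherwise the edge between [i] and [j] occurs once. *)
have [ij_kl|ij_kl] := eqVneq (upper i j) (upper k l).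
  apply: (zero (upper j k)).
  by move: ij_kl ik jl => /eqP; rewrite /= !upper_eq !eqv; lia.
apply: (zero (upper i j)).
by move: ij_kl ik jl; rewrite /= !upper_eq !eqv; lia.
Qed.

End band_moments.

Section trace_moments.
Context (R : realType) (d : measure_display) (T : measurableType d).
Context (P : probability T R) (N b : nat).
Variable h : 'I_N -> 'I_N -> {RV P >-> R}.
Hypotheses (hB : banded_wigner b h) (h4 : four_moment b h).

Let H := random_matrix h.

Lemma random_matrix_sym t : (H t)^T = H t.
Proof. by apply/matrixP => i j; rewrite !mxE; have [->] := hB. Qed.

Lemma expectation_trace2 :
  (\int[P]_t (\tr (H t ^+ 2))%:E = (\sum_(i < N) band_degree R b i)%:E)%E.
Proof.
have trE t : (\tr (H t ^+ 2))%:E = (\sum_(i < N) \sum_(j < N) (h i j t ^+ 2)%:E)%E.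
  rewrite -sumEFin; apply: eq_bigr => i _; rewrite mxE -sumEFin.
  by apply: eq_bigr => j _; rewrite !mxE; have [->] := hB.
under eq_integral do rewrite trE.
have int2 i j : P.-integrable setT (fun t => (h i j t ^+ 2)%:E).
  exact: (entry_integrable hB h4).
rewrite integral_sum//; last by move=> i; exact: integrable_sum.
rewrite -sumEFin; apply: eq_bigr => i _; rewrite integral_sum// -sumEFin.
apply: eq_bigr => j _; rewrite (entry_momentE hB h4)//.
by rewrite /entry_moment; case: ifP.
Qed.

Lemma expectation_trace4 :
  (\int[P]_t (\tr (H t ^+ 4))%:E =
   (2 * \sum_(i < N) band_degree R b i ^+ 2 + \sum_(i < N) band_degree R b i)%:E)%E.
Proof.
have trE t : (\tr (H t ^+ 4))%:E = (\sum_(i < N) \sum_(j < N) \sum_(k < N)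
    \sum_(l < N) (h i j t * h j k t * h k l t * h l i t)%:E)%E.
  rewrite -sumEFin; apply: eq_bigr => i _.
  have -> : H t ^+ 4 = H t *m (H t *m (H t *m H t)) by [].
  rewrite mxE -sumEFin; apply: eq_bigr => j _.
  rewrite [X in _ * X]mxE mulr_sumr -sumEFin; apply: eq_bigr => k _.
  rewrite [X in _ * (_ * X)]mxE !mulr_sumr -sumEFin; apply: eq_bigr => l _.
  by rewrite !mxE !mulrA.
under eq_integral do rewrite trE.
have intw i j k l := (expectation_closed_walk4 hB h4 i j k l).1.
have ints3 i j k : P.-integrable setT (fun t => \sum_(l < N)
    (h i j t * h j k t * h k l t * h l i t)%:E)%E by exact: integrable_sum.
have ints2 i j : P.-integrable setT (fun t => \sum_(k < N) \sum_(l < N)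
    (h i j t * h j k t * h k l t * h l i t)%:E)%E by exact: integrable_sum.
have ints1 i : P.-integrable setT (fun t => \sum_(j < N) \sum_(k < N) \sum_(l < N)
    (h i j t * h j k t * h k l t * h l i t)%:E)%E by exact: integrable_sum.
rewrite integral_sum//; under eq_bigr => i _.
  rewrite integral_sum//; under eq_bigr => j _.
    rewrite integral_sum//; under eq_bigr => k _.
      rewrite integral_sum//; under eq_bigr => l _.
        rewrite (expectation_closed_walk4 hB h4 i j k l).2; over.
      rewrite sumEFin; over.
    rewrite sumEFin; over.
  rewrite sumEFin; over.
rewrite sumEFin; congr (_%:E).
pose B i j : R := (in_band b i j)%:R.
have delta (x : 'I_N) (f : 'I_N -> R) : \sum_(y < N) (x == y)%:R * f y = f x.
  rewrite (bigD1 x)//= eqxx mul1r big1 ?addr0// => y.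
  by rewrite eq_sym => /negbTE ->; rewrite mul0r.
(* The walks with [i = k], those with [j = l] and the correction for both give the three sums in
   turn. *)
transitivity (\sum_(i < N) (band_degree R b i ^+ 2) +
  \sum_(j < N) (band_degree R b j ^+ 2) + \sum_(i < N) (band_degree R b i)); last first.
  by rewrite mulr2n mulrDl mul1r.
under eq_bigr do under eq_bigr do under eq_bigr do rewrite !big_split/=.
under eq_bigr do under eq_bigr do rewrite !big_split/=.
under eq_bigr do rewrite !big_split/=.
rewrite !big_split/=; congr (_ + _ + _).
- apply: eq_bigr => i _; rewrite expr2 {1}/band_degree mulr_suml.
  apply: eq_bigr => j _.
  rewrite -[RHS](delta i (fun=> (in_band b i j)%:R * band_degree R b i)).
  apply: eq_bigr => k _; rewrite -!mulr_sumr//.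
- rewrite exchange_big/=; apply: eq_bigr => j _; rewrite expr2 {1}/band_degree mulr_suml.
  apply: eq_bigr => i _; rewrite in_bandC mulr_sumr; apply: eq_bigr => k _.
  by rewrite (delta j (fun=> (in_band b j i)%:R * (in_band b j k)%:R)).
- apply: eq_bigr => i _; apply: eq_bigr => j _.
  rewrite -[RHS](delta i (fun=> (in_band b i j)%:R)); apply: eq_bigr => k _.
  rewrite -[X in _ = _ * X](delta j (fun=> (in_band b i j)%:R)) mulr_sumr.
  apply: eq_bigr => l _; by case: (i == k); rewrite ?mul1r ?mul0r.
Qed.

End trace_moments.

(** * Moments of the level density *)

Section truncated_power.
Context (R : realType) (k : nat).

(** The cutoff factor is 1 for [|x| <= n - 1], 0 for [|x| >= n] and linear in [|x|] between, which
    makes this an admissible test function for [level_density]. *)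
Definition truncated_power (n : nat) (x : R) : R :=
  x ^+ k * Num.max 0 (Num.min 1 (n%:R - `|x|)).

Lemma continuous_truncated_power n : continuous (truncated_power n).
Proof.
move=> x; apply: cvgM; first exact: exprn_continuous.
apply: (@continuous_max R R (cst 0) (fun y => Num.min 1 (n%:R - `|y|))).
  exact: cvg_cst.
apply: (@continuous_min R R (cst 1) (fun y => n%:R - `|y|)); first exact: cvg_cst.
by apply: cvgB; [exact: cvg_cst|exact: norm_continuous].
Qed.

Lemma compact_support_truncated_power n :
  compact (closure [set x | truncated_power n x != 0]).
Proof.
apply: (subclosed_compact _ (@segment_compact R (- n%:R) n%:R)).
  exact: closed_closure.
have /closure_id -> : closed `[- n%:R : R, n%:R] by exact: itv_closed.
apply: closure_subset => x /=; rewrite in_itv/= -ler_norml; apply: contraNT.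
rewrite -ltNge => nx; rewrite /truncated_power max_l ?mulr0//.
by rewrite ge_min subr_le0 (ltW nx) orbT.
Qed.

Hypothesis k_even : ~~ odd k.

Lemma truncated_power_ge0 n x : 0 <= truncated_power n x.
Proof. by rewrite mulr_ge0 ?exprn_even_ge0// le_max lexx. Qed.

Lemma truncated_power_nd m n x : (m <= n)%N ->
  truncated_power m x <= truncated_power n x.
Proof.
move=> mn; apply: ler_wpM2l; first exact: exprn_even_ge0.
by apply: le_max2 => //; apply: le_min2 => //; rewrite lerD2r ler_nat.
Qed.

(** For even [k] the truncated powers are nonnegative and increase with [n], and at each point they
    are eventually equal to the full power, so monotone convergence applies. *)
Lemma cvg_integral_truncated_power d (T : measurableType d)
    (mu : {measure set T -> \bar R}) (g : T -> R) : measurable_fun setT g ->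
  (\int[mu]_t (truncated_power n (g t))%:E @[n --> \oo] -->
   \int[mu]_t (g t ^+ k)%:E)%E.
Proof.
move=> mg.
have -> : (\int[mu]_t (g t ^+ k)%:E =
    \int[mu]_t limn (fun n => (truncated_power n (g t))%:E))%E.
  apply: eq_integral => t _; apply/esym/cvg_lim => //; apply: cvg_near_cst.
  near=> n; congr (_%:E); rewrite /truncated_power min_l ?max_r ?mulr1//.
  by rewrite lerBrDl; near: n; exact: nbhs_infty_ger.
apply: cvg_monotone_convergence => //.
- move=> n; apply/measurable_EFinP; apply: measurableT_comp => //.
  by apply: continuous_measurable_fun; exact: continuous_truncated_power.
- by move=> n t _; rewrite lee_fin truncated_power_ge0.
- by move=> t _ m n mn; rewrite lee_fin truncated_power_nd.
Unshelve. all: by end_near.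
Qed.

End truncated_power.

Section level_density_moments.
Context (R : realType) (d : measure_display) (T : measurableType d).
Context (P : probability T R) (N : nat).
Variables (h : 'I_N -> 'I_N -> {RV P >-> R}).
Variables (rho : {measure set (measurableTypeR R) -> \bar R}).
Hypothesis hsym : forall t, (random_matrix h t)^T = random_matrix h t.
Hypothesis hrho : level_density h rho.

(** Both sides are limits of their truncations, which agree for each [n] by [level_density]; the sum
    of the powers of the eigenvalues is the trace. *)
Lemma level_density_moment k : ~~ odd k ->
  (\int[rho]_x ((x : R) ^+ k)%:E =
   \int[P]_t (\tr (random_matrix h t ^+ k))%:E)%E.
Proof.
move=> k_even.
pose l i t := tnth (spectrum (random_matrix h t)) i.
have ml i : measurable_fun setT (l i).
  apply: measurable_spectrum => // a b.
  by under eq_fun do rewrite mxE; exact: measurable_funP.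
have lhs := @cvg_integral_truncated_power R k k_even _ _ rho id (@measurable_id _ _ _).
have rhs : (\sum_(i < N) \int[P]_t (truncated_power k n (l i t))%:E
    @[n --> \oo] --> \sum_(i < N) \int[P]_t (l i t ^+ k)%:E)%E.
  apply: cvg_nnesum => i _.
    by apply: nearW => n; apply: integral_ge0 => t _; rewrite lee_fin truncated_power_ge0.
  exact: cvg_integral_truncated_power.
transitivity (\sum_(i < N) \int[P]_t (l i t ^+ k)%:E)%E.
  apply: (cvg_unique _ lhs) => //.
  rewrite (_ : (fun n => _) =
    (fun n => \sum_(i < N) \int[P]_t (truncated_power k n (l i t))%:E)%E)//.
  apply/funext => n; rewrite hrho.
  - by apply: eq_bigr => i _; rewrite unlock.
  - exact: continuous_truncated_power.
  - exact: compact_support_truncated_power.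
rewrite -ge0_integral_sum//.
- apply: eq_integral => t _; rewrite sumEFin; congr (_%:E).
  by have [_ _ ->] := spectrumP (hsym t); rewrite big_tuple.
- by move=> i; exact/measurable_EFinP/measurable_funX.
- by move=> i t _; rewrite lee_fin exprn_even_ge0.
Qed.

End level_density_moments.

(** Rescaling divides the fourth moment by [eta ^+ 4 = (m2 / m0) ^+ 2], and the mass factor
    [nu / eta] is [m0^-1]. *)
Lemma moment_normalised (R : realType)
    (rho : {measure set (measurableTypeR R) -> \bar R}) (m0 m2 m4 : R) :
  0 < m0 -> 0 < m2 ->
  (\int[rho]_x ((x : R) ^+ 0)%:E = m0%:E)%E ->
  (\int[rho]_x ((x : R) ^+ 2)%:E = m2%:E)%E ->
  (\int[rho]_x ((x : R) ^+ 4)%:E = m4%:E)%E ->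
  moment 4 (normalised rho) = m0 * m4 / m2 ^+ 2.
Proof.
move=> m0_gt0 m2_gt0 E0 E2 E4.
have M0 : moment 0 rho = m0 by rewrite /moment E0.
have M2 : moment 2 rho = m2 by rewrite /moment E2.
rewrite /normalised M0 M2.
pose eta := Num.sqrt (m2 / m0); pose nu := Num.sqrt (m2 / m0 ^+ 3).
have eta2 : eta ^+ 2 = m2 / m0 by rewrite sqr_sqrtr// divr_ge0// ltW.
have eta_gt0 : 0 < eta by rewrite sqrtr_gt0 divr_gt0.
have nueta : nu / eta = m0^-1.
  have -> : nu = eta / m0.
    rewrite -[RHS]ger0_norm ?divr_ge0 ?ltW// -sqrtr_sqr; congr Num.sqrt.
    by rewrite expr_div_n eta2; field; rewrite gt_eqF.
  by rewrite mulrAC divff ?mul1r// gt_eqF.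
rewrite -/eta -/nu nueta.
have c_ge0 : 0 <= m0^-1 by rewrite invr_ge0 ltW.
pose rescale : measurableTypeR R -> measurableTypeR R := fun y : R => y / eta.
have mrescale : measurable_fun setT rescale.
  exact: (@measurable_funM _ _ R setT (fun y => y) (fun=> eta^-1)).
(* Up to conversion, [normalised rho] is the pushforward of a scaled measure, to which integration
   lemmas apply. *)
change (moment 4 (pushforward (mscale (NngNum c_ge0) rho) rescale) =
  m0 * m4 / m2 ^+ 2).
have mpow : measurable_fun setT (fun x : measurableTypeR R => (x ^+ 4 : R)%:E).
  by apply/measurable_EFinP; exact: (@measurable_funX _ _ R setT id).
rewrite /moment (ge0_integral_pushforward mrescale)//=; last first.
  by move=> x _; rewrite lee_fin exprn_even_ge0.
rewrite preimage_setT ge0_integral_mscale//=; first last.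
- by move=> x _; rewrite lee_fin exprn_even_ge0.
- by apply/measurable_EFinP; apply: measurable_funX.
under eq_integral do rewrite /rescale expr_div_n mulrC EFinM.
rewrite ge0_integralZl//; first last.
- by rewrite lee_fin invr_ge0 exprn_even_ge0.
- by move=> x _; rewrite lee_fin exprn_even_ge0.
rewrite E4 -!EFinM/= (exprM _ 2 2) eta2.
by field; rewrite !gt_eqF.
Qed.

(** * Counting the band *)

(** Rows of full width [2 * x - 1], minus two corner triangles of [x * (x - 1) / 2] entries each
    that fall outside the matrix. The formula serves both branches. *)
Definition degree_sum (R : pzRingType) (n x : R) : R := (2 * x - 1) * n - x * (x - 1).

(** The first term is twice the sum of the squares from [x] to [2 * x - 1], for the rows at the two
    ends; the other rows have full width. *)
Definition sq_degree_sum1 (R : fieldType) (n x : R) : R :=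
  x * (2 * x - 1) * (7 * x - 1) / 3 + (n - 2 * x) * (2 * x - 1) ^+ 2.

(** The degrees at each end now run from [x] to [n - 1], and the [2 * x - n] middle rows meet every
    column. *)
Definition sq_degree_sum2 (R : fieldType) (n x : R) : R :=
  ((n - 1) * n * (2 * n - 1) - (x - 1) * x * (2 * x - 1)) / 3 +
  (2 * x - n) * n ^+ 2.

Section band_counting.
Context (N b : nat).
Hypothesis (b0 : (0 < b)%N).

Lemma band_degreeE (R : pzSemiRingType) (i : 'I_N) :
  band_degree R b i = (minn (i + b) N - (i.+1 - b))%:R.
Proof.
have count lo hi M : (lo <= hi)%N ->
    (\sum_(0 <= j < M) ((lo <= j) && (j < hi)) = minn hi M - minn lo M)%N.
  move=> lohi; elim: M => [|M IH]; first by rewrite big_nil !minn0.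
  by rewrite big_nat_recr//= IH; lia.
rewrite /band_degree -natr_sum.
rewrite (eq_bigr (fun j : 'I_N => ((i.+1 - b <= j) && (j < i + b)) : nat)%N).
  rewrite -(big_mkord xpredT (fun j => ((i.+1 - b <= j) && (j < i + b)) : nat)%N).
  by rewrite count; [congr (_%:R); have := ltn_ord i; lia|lia].
by move=> j _; rewrite /in_band; congr nat_of_bool; lia.
Qed.

(** The first [c] rows have degrees b, b + 1, and so on, the last [c] rows mirror them, and the
    degree is constant in between. The minimum in [c] covers both positions of [2 * b] relative to
    [N]. *)
Lemma sum_band_degree (R : pzSemiRingType) (f : R -> R) (c := minn b (N - b)) :
  (b <= N)%N ->
  \sum_(i < N) f (band_degree R b i) =
  (\sum_(i < c) f (b + i)%:R) *+ 2 + f (minn (2 * b - 1) N)%:R *+ (N - 2 * c).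
Proof.
move=> bN; pose F i := f (minn (i + b) N - (i.+1 - b))%:R.
under eq_bigr do rewrite band_degreeE -/(F _).
rewrite -(big_mkord xpredT F) (big_cat_nat (n := c))/=; [|lia|lia].
rewrite (big_cat_nat (n := (N - c)%N) (m := c))/=; [|lia|lia].
rewrite addrCA -[X in _ = X]addrC; congr (_ + _).
  rewrite (@eq_big_nat _ _ _ _ _ _ (fun=> f (minn (2 * b - 1) N)%:R)).
    by rewrite sumr_const_nat; congr (_ *+ _); lia.
  by move=> i hi; rewrite /F; congr (f _%:R); lia.
rewrite mulr2n big_mkord; congr (_ + _).
  by apply: eq_bigr => i _; rewrite /F; congr (f _%:R); have := ltn_ord i; lia.
rewrite big_rev_mkord (_ : N - (N - c) = c)%N; last lia.
by apply: eq_bigr => i _; rewrite /F; congr (f _%:R); have := ltn_ord i; lia.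
Qed.

Lemma sum_arith (R : realFieldType) c :
  \sum_(i < c) (b + i)%:R = c%:R * b%:R + c%:R * (c%:R - 1) / 2 :> R.
Proof.
elim: c => [|c IH]; first by rewrite big_ord0; ring.
by rewrite big_ord_recr /= IH natrD -[c.+1]addn1 natrD; field.
Qed.

Lemma sum_arith_sq (R : realFieldType) c :
  \sum_(i < c) (b + i)%:R ^+ 2 =
  c%:R * b%:R ^+ 2 + b%:R * c%:R * (c%:R - 1)
    + (c%:R - 1) * c%:R * (2 * c%:R - 1) / 6 :> R.
Proof.
elim: c => [|c IH]; first by rewrite big_ord0; ring.
by rewrite big_ord_recr /= IH natrD -[c.+1]addn1 natrD; field.
Qed.

Lemma sum_degree (R : realFieldType) : (b <= N)%N ->
  \sum_(i < N) band_degree R b i = degree_sum N%:R b%:R.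
Proof.
move=> bN; rewrite (sum_band_degree id)//= sum_arith /degree_sum.
have [h|h] := leqP (2 * b) N.
  rewrite (_ : minn b (N - b) = b); last lia.
  rewrite (_ : minn _ N = 2 * b - 1)%N; last lia.
  rewrite -mulr_natr -[X in _ + X]mulr_natr !natrB ?natrM; [|lia..].
  by field.
rewrite (_ : minn b (N - b) = N - b)%N; last lia.
rewrite (_ : minn _ N = N)%N; last lia.
rewrite -mulr_natr -[X in _ + X]mulr_natr (_ : N - 2 * (N - b) = 2 * b - N)%N; last lia.
rewrite !natrB ?natrM; [|lia..].
by field.
Qed.

Lemma sum_sq_degree1 (R : realFieldType) : (2 * b <= N)%N ->
  \sum_(i < N) band_degree R b i ^+ 2 = sq_degree_sum1 N%:R b%:R.
Proof.
move=> h; rewrite (sum_band_degree (fun x => x ^+ 2)); last lia.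
rewrite sum_arith_sq /sq_degree_sum1.
rewrite (_ : minn b (N - b) = b); last lia.
rewrite (_ : minn _ N = 2 * b - 1)%N; last lia.
rewrite -mulr_natr -[X in _ + X]mulr_natr !natrB ?natrM; [|lia..].
by field.
Qed.

Lemma sum_sq_degree2 (R : realFieldType) : (b <= N <= 2 * b)%N ->
  \sum_(i < N) band_degree R b i ^+ 2 = sq_degree_sum2 N%:R b%:R.
Proof.
move=> /andP[bN h]; rewrite (sum_band_degree (fun x => x ^+ 2))//.
rewrite sum_arith_sq /sq_degree_sum2.
rewrite (_ : minn b (N - b) = N - b)%N; last lia.
(* At [2 * b = N] the constant middle degree would be [N - 1] instead of [N], but there are no
   middle rows. *)
have [h2|h2] := eqVneq (2 * b)%N N.
  rewrite (_ : N - 2 * (N - b) = 0)%N; last lia.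
  rewrite mulr0n -mulr_natr !natrB; [|lia..].
  have -> : N%:R = 2 * b%:R :> R by rewrite -h2 natrM.
  by field.
rewrite (_ : minn _ N = N)%N; last lia.
rewrite -mulr_natr -[X in _ + X]mulr_natr (_ : N - 2 * (N - b) = 2 * b - N)%N; last lia.
rewrite !natrB ?natrM; [|lia..].
by field.
Qed.

End band_counting.

(** * Critical points of the closed form *)

Section moment_branches.
Context (R : realFieldType).
Implicit Types n x y z c m s t : R.

Definition degree_sum_poly n : {poly R} := Poly [:: - n; 2 * n + 1; -1].

Definition trace4_poly1 n : {poly R} :=
  Poly [:: n; - (6 * n + 7 / 3); 8 * n + 9; - (20 / 3)].

Definition trace4_poly2 n : {poly R} :=
  Poly [:: - (2 / 3 * n ^+ 3 + 2 * n ^+ 2 + n / 3);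
           4 * n ^+ 2 + 2 * n + 1 / 3; 1; - (4 / 3)].

(* The derivative of [p / q ^+ 2] is [slope p q / q ^+ 3]. *)
Definition slope (p q : {poly R}) : {poly R} := p^`() * q - 2%:P * p * q^`().

Lemma horner_degree_sum_poly n x : (degree_sum_poly n).[x] = degree_sum n x.
Proof. by rewrite /degree_sum_poly horner_Poly /= /degree_sum; ring. Qed.

Lemma horner_trace4_poly1 n x :
  (trace4_poly1 n).[x] = 2 * sq_degree_sum1 n x + degree_sum n x.
Proof.
by rewrite /trace4_poly1 horner_Poly /= /sq_degree_sum1 /degree_sum; field.
Qed.

Lemma horner_trace4_poly2 n x :
  (trace4_poly2 n).[x] = 2 * sq_degree_sum2 n x + degree_sum n x.
Proof.
by rewrite /trace4_poly2 horner_Poly /= /sq_degree_sum2 /degree_sum; field.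
Qed.

Lemma degree_sum_gt0 n x : 1 <= x <= n -> 0 < degree_sum n x.
Proof. by move=> /andP[x1 xn]; rewrite /degree_sum; nra. Qed.

Lemma trace4_poly12 n : (trace4_poly1 n).[n / 2] = (trace4_poly2 n).[n / 2].
Proof. by rewrite !horner_Poly /=; field. Qed.

Definition slope1 n := slope (trace4_poly1 n) (degree_sum_poly n).
Definition slope2 n := slope (trace4_poly2 n) (degree_sum_poly n).

(** Centred at 1 because, for [2 <= n], the coefficients of 1, [t] and [t ^+ 4] are then negative,
    as [quartic_le2_pos_roots] requires. *)
Lemma horner_slope1 n t : (slope1 n).[1 + t] =
  - (20 / 3) * t ^+ 4 + (8 / 3 * n - 46 / 3) * t ^+ 3 + (10 * n - 13) * t ^+ 2
  - (4 * n ^+ 2 - 26 / 3 * n + 13 / 3) * t - (2 * n ^+ 2 - 5 / 3 * n).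
Proof.
rewrite /slope1 /slope /trace4_poly1 /degree_sum_poly /= !cons_poly_def.
by rewrite !poly.derivE !hornerE /=; field.
Qed.

(** The coordinates [c = n - x] and [m = 2 * x - n] are nonnegative on the second branch, and only
    the monomials [7 / 3 * c ^+ 2] and [c / 3] have positive coefficients. *)
Lemma horner_slope2 c m : (slope2 (2 * c + m)).[c + m] =
  - (4 / 3) * c ^+ 4 - 8 * c ^+ 3 * m - 2 / 3 * c ^+ 3 - 4 * c ^+ 2 * m ^+ 2
  - 12 * c ^+ 2 * m + 7 / 3 * c ^+ 2 - 6 * c * m ^+ 2 - 8 / 3 * c * m + c / 3
  - 5 / 3 * m ^+ 2.
Proof.
rewrite /slope2 /slope /trace4_poly2 /degree_sum_poly /= !cons_poly_def.
by rewrite !poly.derivE !hornerE /=; field.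
Qed.

Lemma slope2_lt0 n x : 4 <= n -> n / 2 <= x <= n -> (slope2 n).[x] < 0.
Proof.
move=> n4 /andP[nx xn]; pose c := n - x; pose m := 2 * x - n.
have -> : n = 2 * c + m by rewrite /c /m; ring.
have -> : x = c + m by rewrite /c /m; ring.
have c0 : 0 <= c by rewrite /c; lra.
have m0 : 0 <= m by rewrite /m; lra.
have cm : 4 <= 2 * c + m by rewrite /c /m; lra.
rewrite horner_slope2; clearbody c m; clear n4 nx xn.
have h1 := mulr_ge0 (exprn_ge0 3 c0) m0.
have h2 := mulr_ge0 (exprn_ge0 2 c0) m0.
have h3 := mulr_ge0 c0 m0.
have h4 := exprn_ge0 3 c0; have h5 := exprn_ge0 4 c0.
have h6 := mulr_ge0 (exprn_ge0 2 c0) (exprn_ge0 2 m0).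
have h7 := mulr_ge0 c0 (exprn_ge0 2 m0).
have h8 := exprn_ge0 2 c0; have h9 := exprn_ge0 2 m0.
(* For [2 <= c] the quartic term absorbs the two positive monomials. For smaller [c], the bound [cm]
   forces [0 < m], and the term in [m ^+ 2] keeps the inequality strict even at [c = 0]. *)
have [c2|c2] := leP 2 c.
  have : 4 * c ^+ 2 <= c ^+ 4 by nra.
  nra.
have m2 : 0 < m by lra.
have m22 : 0 < m ^+ 2 by exact: exprn_gt0.
nra.
Qed.

(* Dividing by [t ^+ 2] turns such a quartic into a strictly concave function:
   the identity below says that its second divided difference vanishes. *)
Lemma quartic_le2_pos_roots (c0 c1 c2 c3 c4 x y z : R) :
  c0 < 0 -> c1 < 0 -> c4 < 0 -> 0 < x -> 0 < y -> 0 < z ->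
  x != y -> y != z -> x != z ->
  let f t := c4 * t ^+ 4 + c3 * t ^+ 3 + c2 * t ^+ 2 + c1 * t + c0 in
  f x = 0 -> f y = 0 -> f z = 0 -> False.
Proof.
move=> c0n c1n c4n x0 y0 z0 xy yz xz f fx fy fz.
have : (y - x) * (z - x) * (z - y) *
    (c0 * (x * y + y * z + z * x) + c1 * (x * y * z) + c4 * (x * y * z) ^+ 2) = 0.
  transitivity (f x * (y * z) ^+ 2 * (z - y) - f y * (x * z) ^+ 2 * (z - x)
    + f z * (x * y) ^+ 2 * (y - x)); first by rewrite /f; ring.
  by rewrite fx fy fz !mul0r subrr addr0.
have dist : (y - x) * (z - x) * (z - y) != 0.
  by rewrite !mulf_neq0// subr_eq0 eq_sym.
move/eqP; rewrite mulf_eq0 (negbTE dist) /= lt_eqF//.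
have xy0 := mulr_gt0 x0 y0; have yz0 := mulr_gt0 y0 z0; have zx0 := mulr_gt0 z0 x0.
have xyz0 := mulr_gt0 xy0 z0; have xyz2 := exprn_gt0 2 xyz0.
by rewrite -!oppr_gt0 !opprD -!mulNr !addr_gt0 ?mulr_gt0 ?addr_gt0 ?oppr_gt0.
Qed.

Lemma slope1_le2_roots n x y z : 2 <= n -> 1 < x -> 1 < y -> 1 < z ->
  x != y -> y != z -> x != z ->
  root (slope1 n) x -> root (slope1 n) y -> root (slope1 n) z -> False.
Proof.
move=> n2 x1 y1 z1 xy yz xz.
have fE u : (slope1 n).[u] = - (20 / 3) * (u - 1) ^+ 4 +
    (8 / 3 * n - 46 / 3) * (u - 1) ^+ 3 + (10 * n - 13) * (u - 1) ^+ 2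
    + (- (4 * n ^+ 2 - 26 / 3 * n + 13 / 3)) * (u - 1) + (- (2 * n ^+ 2 - 5 / 3 * n)).
  by rewrite -{1}(subrK 1 u) addrC horner_slope1 !mulNr.
move=> /rootP + /rootP + /rootP; rewrite !fE.
apply: quartic_le2_pos_roots; rewrite ?subr_gt0 ?(inj_eq (subIr _)) //; nra.
Qed.

(** Here [s] stands for the square root of [3 * n / 2]. At [t = s + e] in [horner_slope1] the terms
    in [s ^+ 5] cancel and [s ^+ 4] has coefficient [(32 * e - 8) / 9], with [e = -3] here and
    [e = 1] in the next lemma. Expanding around 20 leaves coefficients of one sign. *)
Lemma slope1_sqrt_lt0 s : 20 <= s -> (slope1 (2 / 3 * s ^+ 2)).[s - 2] < 0.
Proof.
move=> s20; rewrite (_ : s - 2 = 1 + (s - 3)); last by ring.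
rewrite horner_slope1; pose u := s - 20.
have u0 : 0 <= u by rewrite subr_ge0.
have -> : s = u + 20 by rewrite subrK.
have h2 := exprn_ge0 2 u0; have h3 := exprn_ge0 3 u0; have h4 := exprn_ge0 4 u0.
lra.
Qed.

Lemma slope1_sqrt_gt0 s : 20 <= s -> 0 < (slope1 (2 / 3 * s ^+ 2)).[s + 2].
Proof.
move=> s20; rewrite (_ : s + 2 = 1 + (s + 1)); last by ring.
rewrite horner_slope1; pose u := s - 20.
have u0 : 0 <= u by rewrite subr_ge0.
have -> : s = u + 20 by rewrite subrK.
have h2 := exprn_ge0 2 u0; have h3 := exprn_ge0 3 u0; have h4 := exprn_ge0 4 u0.
lra.
Qed.

(** At [t = 2 / 5 * n + e] the terms in [n ^+ 4] cancel and [n ^+ 3] has coefficient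
    [- (160 * e + 368) / 375], which is positive for [e = -3] here and negative for [e = 1] in the
    next lemma. *)
Lemma slope1_linear_gt0 n : 100 <= n -> 0 < (slope1 n).[2 / 5 * n - 2].
Proof.
move=> n0; rewrite (_ : _ - 2 = 1 + (2 / 5 * n - 3)); last by ring.
rewrite horner_slope1; pose u := n - 100.
have u0 : 0 <= u by rewrite subr_ge0.
have -> : n = u + 100 by rewrite subrK.
have h2 := exprn_ge0 2 u0; have h3 := exprn_ge0 3 u0; have h4 := exprn_ge0 4 u0.
lra.
Qed.

Lemma slope1_linear_lt0 n : 100 <= n -> (slope1 n).[2 / 5 * n + 2] < 0.
Proof.
move=> n0; rewrite (_ : _ + 2 = 1 + (2 / 5 * n + 1)); last by ring.
rewrite horner_slope1; pose u := n - 100.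
have u0 : 0 <= u by rewrite subr_ge0.
have -> : n = u + 100 by rewrite subrK.
have h2 := exprn_ge0 2 u0; have h3 := exprn_ge0 3 u0; have h4 := exprn_ge0 4 u0.
lra.
Qed.

End moment_branches.

(** * Derivatives and identification of rational functions *)

Lemma is_derive_poly_quotient (R : realType) (p q : {poly R}) (x : R) : q.[x] != 0 ->
  is_derive x (1 : R) (fun y => p.[y] / (q ^+ 2).[y])
    ((slope p q).[x] / q.[x] ^+ 3).
Proof.
move=> q0; have q20 : (q ^+ 2).[x] != 0 by rewrite horner_exp expf_neq0.
have := is_deriveM (is_derive_poly p x) (is_deriveV q20 (is_derive_poly (q ^+ 2) x)).
move/is_derive_eq; apply; rewrite /slope expr2 derivM !hornerE /=.
by rewrite /GRing.scale/=; field.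
Qed.

(* Differentiability at [x] is two-sided, so values on the left of [x] are
   enough to determine the derivative. *)
Lemma is_derive_left_unique (R : realType) (f g : R -> R) (a x df dg : R) : a < x ->
  (forall y, a <= y <= x -> f y = g y) ->
  is_derive x (1 : R) f df -> is_derive x (1 : R) g dg -> df = dg.
Proof.
move=> ax fg [cf <-] [cg <-].
have cf' := cvg_dnbhs_at_left cf; have cg' := cvg_dnbhs_at_left cg.
apply: (cvg_unique _ cf') => //; apply: cvg_trans cg'.
apply: near_eq_cvg; near=> t.
have t0 : t < 0 by near: t; exact: nbhs_left_lt.
have at_ : a - x <= t by near: t; apply: nbhs_left_ge; rewrite subr_lt0.
rewrite /= /shift /= /GRing.scale/= mulr1 !fg ?lexx ?(ltW ax)//.
by rewrite -lerBlDr at_ gerDr ltW.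
Unshelve. all: by end_near.
Qed.

(** After cross-multiplication, [p1 * q - p * q1] has size at most [n + k] and vanishes at more than
    [n + k] integers, so it is 0. *)
Lemma rational_on_eq (R : realType) (D : set R) (n k lo m : nat) (F : R -> R)
    (p q : {poly R}) :
  rational_on D n F -> (size p <= k)%N -> (size q <= k)%N ->
  (forall x, D x -> q.[x] != 0) ->
  (forall i, (lo <= i < lo + m)%N -> D i%:R /\ F i%:R = p.[i%:R] / q.[i%:R]) ->
  (n + k < m)%N -> forall x, D x -> F x = p.[x] / q.[x].
Proof.
move=> [p1 [q1 [sp1 sq1 F1]]] sp sq q0 Fi nkm x Dx.
have [q1x ->] := F1 x Dx.
suff /subr0_eq e : p1 * q - p * q1 = 0.
  have := congr1 (fun r : {poly R} => r.[x]) e; rewrite !hornerM => ex.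
  by apply/eqP; rewrite eqr_div ?q0// ex.
have natrI : injective (fun i : nat => i%:R : R).
  by move=> i j /eqP; rewrite eqr_nat => /eqP.
apply: (@roots_geq_poly_eq0 _ _ [seq i%:R | i <- iota lo m]).
- apply/allP => y /mapP[j]; rewrite mem_iota => lom ->{y}.
  have [Di FiE] := Fi j lom; have [q1i FE] := F1 _ Di.
  rewrite rootE hornerD hornerN !hornerM subr_eq0 -eqr_div ?q0//.
  by rewrite -FE FiE.
- by rewrite map_inj_uniq ?iota_uniq.
rewrite size_map size_iota.
apply: leq_trans (size_polyD _ _) _; rewrite size_polyN geq_max.
apply/andP; split; apply: leq_trans (size_polyMleq _ _) _.
  by apply: leq_trans (ltnW nkm); rewrite -subn1 leq_subLR add1n -addSn leq_add.
by apply: leq_trans (ltnW nkm); rewrite -subn1 leq_subLR add1n -addSn addnC leq_add.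
Qed.

Definition fourth_moment_branch (R : fieldType) (A : R -> {poly R})
    (q : {poly R}) (n x : R) : R :=
  (n *: A n).[x] / (q ^+ 2).[x].

Lemma slopeZ (R : realFieldType) (c : R) (p q : {poly R}) :
  slope (c *: p) q = c *: slope p q.
Proof.
by rewrite /slope derivZ scalerBr -scalerAl -!scalerAr !scalerAl.
Qed.

Lemma critical_points_branches (R : realType) (N : nat) (F : R -> R)
    (n := N%:R : R) : (1000 <= N)%N ->
  (forall x, 1 <= x <= n / 2 ->
     F x = fourth_moment_branch (@trace4_poly1 R) (degree_sum_poly n) n x) ->
  (forall x, n / 2 <= x <= n ->
     F x = fourth_moment_branch (@trace4_poly2 R) (degree_sum_poly n) n x) ->
  exists b1 b2, [/\ `|b1 - Num.sqrt (3 * n / 2)| <= 2, `|b2 - 2 / 5 * n| <= 2,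
    b1 != b2 & critical_points N F = [set b1; b2]].
Proof.
move=> N1000 F1 F2.
have n1000 : 1000 <= n by rewrite (ler_nat R 1000 N).
have n_gt0 : 0 < n by lra.
set s := Num.sqrt _.
have s2 : s ^+ 2 = 3 * n / 2 by rewrite sqr_sqrtr//; lra.
have s0 : 0 <= s by exact: sqrtr_ge0.
have s20 : 20 <= s by nra.
(* With [1000 <= n] this puts both brackets inside []1, n / 2[], the first one below the second. *)
have sn : s <= n / 20 by nra.
have nE : n = 2 / 3 * s ^+ 2 by rewrite s2; field.
have [b1 b1s rb1] : exists2 x, s - 2 <= x <= s + 2 & root (slope1 n) x.
  apply: poly_ivt; first lra.
  by rewrite nE (ltW (slope1_sqrt_lt0 s20)) (ltW (slope1_sqrt_gt0 s20)).
have [b2 b2n rb2] : exists2 x, 2 / 5 * n - 2 <= x <= 2 / 5 * n + 2 &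
    root (slope1 n) x.
  have n100 : 100 <= n by lra.
  (* The sign goes from positive to negative here, so the intermediate value theorem is applied to
     the opposite polynomial. *)
  have [||x xn] := @poly_ivt R (- slope1 n) (2 / 5 * n - 2) (2 / 5 * n + 2).
  - lra.
  - by rewrite !hornerN oppr_le0 oppr_ge0 !ltW ?slope1_linear_lt0 ?slope1_linear_gt0.
  by rewrite rootN; exists x.
have b12 : b1 < b2 by lra.
have q_neq0 x : 1 <= x <= n -> (degree_sum_poly n).[x] != 0.
  by move=> x1n; rewrite horner_degree_sum_poly gt_eqF// degree_sum_gt0.
have dM (A : R -> {poly R}) x : 1 <= x <= n -> is_derive x (1 : R)
    (fourth_moment_branch A (degree_sum_poly n) n)
    (n * (slope (A n) (degree_sum_poly n)).[x] / (degree_sum_poly n).[x] ^+ 3).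
  move=> /q_neq0 qx; have := is_derive_poly_quotient (n *: A n) qx.
  by rewrite slopeZ hornerZ.
have dM0 (A : R -> {poly R}) x : 1 <= x <= n ->
    n * (slope (A n) (degree_sum_poly n)).[x] / (degree_sum_poly n).[x] ^+ 3 = 0 ->
    (slope (A n) (degree_sum_poly n)).[x] = 0.
  move=> /q_neq0 qx /eqP; rewrite !mulf_eq0 invr_eq0 expf_eq0/= (negbTE qx) orbF.
  by rewrite (gt_eqF n_gt0) => /eqP.
exists b1, b2; split.
- by rewrite ler_norml; lra.
- by rewrite ler_norml; lra.
- by rewrite lt_eqF.
have crit x : 1 < x < n / 2 -> root (slope1 n) x -> critical_points N F x.
  move=> /andP[x1 xn] /rootP rx; split; first by rewrite -/n; lra.
  have := dM (@trace4_poly1 R) x; rewrite -/(slope1 n) rx mulr0 mul0r => D0.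
  apply: near_eq_is_derive (D0 _); last lra.
  have xI : x \in `]1, n / 2[ by rewrite in_itv/= x1.
  near=> y; rewrite F1//.
  suff : y \in `]1, n / 2[ by rewrite in_itv/= => /andP[y1 yn]; rewrite !ltW.
  by near: y; exact: near_in_itvoo.
apply/seteqP; split=> x /=; last first.
  by move=> [->|->]; apply: crit => //; lra.
move=> [/andP[x1]]; rewrite -/n => xn dF.
have x1n : 1 <= x <= n by lra.
(* The point [n / 2] itself falls into the first case: its derivative is read off on the left, where
   the first branch holds. *)
have [xn2|xn2] := leP x (n / 2).
  have F1' y : 1 <= y <= x -> F y =
      fourth_moment_branch (@trace4_poly1 R) (degree_sum_poly n) n y.
    by move=> /andP[y1 yx]; apply: F1; lra.
  have /esym/(dM0 _ _ x1n)/rootP rx := is_derive_left_unique x1 F1' dF (dM _ _ x1n).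
  apply/or_asboolP; apply: contrapT => /negP; rewrite negb_or => /andP[].
  move=> /asboolPn/eqP xb1 /asboolPn/eqP xb2.
  by apply: (@slope1_le2_roots R n b1 b2 x) => //; rewrite 1?eq_sym//; lra.
have F2' y : n / 2 <= y <= x -> F y =
    fourth_moment_branch (@trace4_poly2 R) (degree_sum_poly n) n y.
  by move=> /andP[y1 yx]; apply: F2; lra.
have /esym/(dM0 _ _ x1n) := is_derive_left_unique xn2 F2' dF (dM _ _ x1n).
have n4 : 4 <= n by lra.
by have /(slope2_lt0 n4)/lt_eqF/eqP : n / 2 <= x <= n by lra.
Unshelve. all: by end_near.
Qed.

(** * The fourth moment as a function of the bandwidth *)

Lemma fourth_moment_degrees (R : realType) (d : measure_display)
    (T : measurableType d) (P : probability T R) (N b : nat)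
    (h : 'I_N -> 'I_N -> {RV P >-> R})
    (rho : {measure set (measurableTypeR R) -> \bar R}) :
  (1 <= b <= N)%N -> banded_wigner b h -> four_moment b h -> level_density h rho ->
  moment 4 (normalised rho) =
    N%:R * (2 * \sum_(i < N) band_degree R b i ^+ 2 + degree_sum N%:R b%:R) /
    degree_sum N%:R b%:R ^+ 2.
Proof.
move=> /andP[b0 bN] hB h4 hrho.
have hsym := random_matrix_sym hB.
have S1 := sum_degree b0 R bN.
rewrite (@moment_normalised _ rho N%:R (degree_sum N%:R b%:R)
  (2 * \sum_(i < N) band_degree R b i ^+ 2 + degree_sum N%:R b%:R))//.
- by rewrite ltr0n (leq_trans b0).
- by rewrite degree_sum_gt0// ler1n b0 ler_nat.
(* The zeroth moment is the expected trace of the identity matrix, which is [N]. *)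
- rewrite (level_density_moment hsym hrho)//.
  under eq_integral do rewrite expr0 mxtrace1.
  by rewrite integral_cst// -[RHS]mule1; congr (_ * _)%E; exact: probability_setT.
- by rewrite (level_density_moment hsym hrho)// (expectation_trace2 hB h4) S1.
- by rewrite (level_density_moment hsym hrho)// (expectation_trace4 hB h4) S1.
Qed.

Section continuation.
Context (R : realType).
Implicit Types (N b : nat) (n x : R).

Definition branch1 n x :=
  fourth_moment_branch (@trace4_poly1 R) (degree_sum_poly n) n x.

Definition branch2 n x :=
  fourth_moment_branch (@trace4_poly2 R) (degree_sum_poly n) n x.

Lemma size_sq_degree_sum_poly n : (size (degree_sum_poly n ^+ 2)%R <= 5)%N.
Proof.
apply: leq_trans (size_poly_exp_leq _ _) _.
have : (size (degree_sum_poly n) <= 3)%N by exact: size_Poly.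
by lia.
Qed.

Lemma size_trace4_poly1 n : (size (n *: trace4_poly1 n)%R <= 5)%N.
Proof. by apply: leq_trans (size_scale_leq _ _) (leqW (size_Poly _)). Qed.

Lemma size_trace4_poly2 n : (size (n *: trace4_poly2 n)%R <= 5)%N.
Proof. by apply: leq_trans (size_scale_leq _ _) (leqW (size_Poly _)). Qed.

Lemma sq_degree_sum_poly_neq0 n x : 1 <= x <= n -> (degree_sum_poly n ^+ 2).[x] != 0.
Proof.
move=> xn; rewrite horner_exp expf_neq0// horner_degree_sum_poly.
by rewrite gt_eqF// degree_sum_gt0.
Qed.

Lemma branch12 n : branch1 n (n / 2) = branch2 n (n / 2).
Proof. by rewrite /branch1 /branch2 /fourth_moment_branch !hornerZ trace4_poly12. Qed.

Variable m : nat -> nat -> R.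
Hypothesis mE : forall N b, (1 <= b <= N)%N ->
  m N b = N%:R * (2 * \sum_(i < N) band_degree R b i ^+ 2 + degree_sum N%:R b%:R) /
    degree_sum N%:R b%:R ^+ 2.

Lemma branch1E N b : (0 < b)%N -> (2 * b <= N)%N -> m N b = branch1 N%:R b%:R.
Proof.
move=> b0 bN; rewrite mE; last lia.
rewrite /branch1 /fourth_moment_branch hornerZ horner_exp horner_degree_sum_poly.
by rewrite horner_trace4_poly1 (sum_sq_degree1 b0).
Qed.

Lemma branch2E N b : (0 < b)%N -> (b <= N <= 2 * b)%N -> m N b = branch2 N%:R b%:R.
Proof.
move=> b0 bN; rewrite mE; last lia.
rewrite /branch2 /fourth_moment_branch hornerZ horner_exp horner_degree_sum_poly.
by rewrite horner_trace4_poly2 (sum_sq_degree2 b0).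
Qed.

Lemma ler_half_nat N b : (b%:R <= N%:R / 2 :> R) = (2 * b <= N)%N.
Proof. by rewrite ler_pdivlMr// -natrM ler_nat mulnC. Qed.

Lemma ger_half_nat N b : (N%:R / 2 <= b%:R :> R) = (N <= 2 * b)%N.
Proof. by rewrite ler_pdivrMr// -natrM ler_nat mulnC. Qed.

Lemma exists_bandwidth_continuation : exists F, bandwidth_continuation m F.
Proof.
exists (fun N x => if x <= N%:R / 2 then branch1 N%:R x else branch2 N%:R x).
(* The numerators have degree at most 3, the squared denominator at most 4. *)
exists 4; near=> N; split.
- move=> b /andP[b1 bN]; rewrite ler_half_nat.
  by case: leqP => h; [rewrite branch1E|rewrite branch2E]=> //; lia.
- exists (N%:R *: trace4_poly1 N%:R), (degree_sum_poly N%:R ^+ 2).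
  split; [exact: size_trace4_poly1|exact: size_sq_degree_sum_poly|].
  move=> x /=; rewrite in_itv/= => /andP[x1 xN]; rewrite xN.
  by split=> //; apply: sq_degree_sum_poly_neq0; lra.
- exists (N%:R *: trace4_poly2 N%:R), (degree_sum_poly N%:R ^+ 2).
  split; [exact: size_trace4_poly2|exact: size_sq_degree_sum_poly|].
  have N2 : 2 <= N%:R :> R by near: N; exact: nbhs_infty_ger.
  move=> x /=; rewrite in_itv/= => /andP[Nx xN]; split.
    by apply: sq_degree_sum_poly_neq0; lra.
  case: ifPn => // xN2; have -> : x = N%:R / 2 by lra.
  exact: branch12.
Unshelve. all: by end_near.
Qed.

Lemma bandwidth_continuationE F : bandwidth_continuation m F ->
  \forall N \near \oo,
    (forall x, 1 <= x <= N%:R / 2 -> F N x = branch1 N%:R x) /\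
    (forall x, N%:R / 2 <= x <= N%:R -> F N x = branch2 N%:R x).
Proof.
move=> [n Fn]; near=> N.
have [FN F1 F2] : [/\ forall b, (1 <= b <= N)%N -> F N b%:R = m N b,
    rational_on `[1, N%:R / 2] n (F N) & rational_on `[N%:R / 2, N%:R] n (F N)].
  by near: N.
(* Each half of [[1, N]] then contains more than [n + 5] integers, which [rational_on_eq] requires
   for polynomials of size at most 5. *)
have Nn : (2 * (n + 7) <= N)%N by near: N; exact: nbhs_infty_ge.
have N2 : 2 <= N%:R :> R by rewrite (ler_nat R 2); lia.
split=> x xN.
  apply: (rational_on_eq (lo := 1) (m := N./2) F1 (size_trace4_poly1 _)
    (size_sq_degree_sum_poly _)).
  - by move=> y /=; rewrite in_itv/= => yN; apply: sq_degree_sum_poly_neq0; lra.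
  - move=> i iN; split.
      by rewrite /= in_itv/= ler1n ler_half_nat; lia.
    by rewrite FN ?branch1E//; lia.
  - lia.
  - by rewrite /= in_itv.
apply: (rational_on_eq (lo := N./2.+1) (m := (N - N./2)%N) F2 (size_trace4_poly2 _)
  (size_sq_degree_sum_poly _)).
- by move=> y /=; rewrite in_itv/= => yN; apply: sq_degree_sum_poly_neq0; lra.
- move=> i iN; split.
    by rewrite /= in_itv/= ger_half_nat ler_nat; lia.
  by rewrite FN ?branch2E//; lia.
- lia.
- by rewrite /= in_itv.
Unshelve. all: by end_near.
Qed.

End continuation.

Theorem theorem1 (R : realType)
    (d : nat -> nat -> measure_display)
    (T : forall N b : nat, measurableType (d N b))
    (P : forall N b : nat, probability (T N b) R)
    (h : forall N b : nat, 'I_N -> 'I_N -> {RV (P N b) >-> R})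
    (rho : nat -> nat -> {measure set (measurableTypeR R) -> \bar R})
    (hBWE : forall N b : nat, (1 <= b <= N)%N -> banded_wigner b (h N b))
    (hfour : forall N b : nat, (1 <= b <= N)%N -> four_moment b (h N b))
    (hrho : forall N b : nat, (1 <= b <= N)%N ->
       level_density (h N b) (rho N b)) :
  let m4 := fun N b : nat => moment 4 (normalised (rho N b)) in
  (exists F : nat -> R -> R, bandwidth_continuation m4 F) /\
  forall F : nat -> R -> R, bandwidth_continuation m4 F ->
    exists b1 b2 : nat -> R,
      [/\ \forall N \near \oo,
            b1 N != b2 N /\ critical_points N (F N) = [set b1 N; b2 N],
          (fun N : nat => b1 N - Num.sqrt (3 * N%:R / 2)) =o_\oo
            (fun N : nat => Num.sqrt (N%:R : R)) &
          (fun N : nat => b2 N - 2 / 5 * N%:R) =o_\oo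
            (fun N : nat => N%:R : R)].
Proof.
move=> m4.
have m4E N b : (1 <= b <= N)%N -> m4 N b =
    N%:R * (2 * \sum_(i < N) band_degree R b i ^+ 2 + degree_sum N%:R b%:R) /
    degree_sum N%:R b%:R ^+ 2.
  by move=> Nb; apply: (fourth_moment_degrees (h := h N b)) => //;
    [exact: hBWE|exact: hfour|exact: hrho].
split=> [|F FE]; first exact: (exists_bandwidth_continuation m4E).
pose good N (b : R * R) := [/\ `|b.1 - Num.sqrt (3 * N%:R / 2)| <= 2,
  `|b.2 - 2 / 5 * N%:R| <= 2, b.1 != b.2 & critical_points N (F N) = [set b.1; b.2]].
(* The pair [(0, 0)] is a default for the dimensions that admit no good pair; by [gb] there are
   finitely many. *)
have /choice[b bP] N : exists b, (exists b', good N b') -> good N b.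
  by have [[b' gb]|] := pselect (exists b', good N b'); [exists b'|exists (0, 0)].
have gb : \forall N \near \oo, good N (b N).
  near=> N; apply: bP.
  have [F1 F2] : (forall x, 1 <= x <= N%:R / 2 -> F N x = branch1 N%:R x) /\
      (forall x, N%:R / 2 <= x <= N%:R -> F N x = branch2 N%:R x).
    by near: N; exact: bandwidth_continuationE m4E _ FE.
  have N1000 : (1000 <= N)%N by near: N; exact: nbhs_infty_ge.
  have [x1 [x2 g]] := critical_points_branches N1000 F1 F2.
  by exists (x1, x2).
exists (fun N => (b N).1), (fun N => (b N).2); split.
- by apply: filterS gb => N [].
(* The error is at most 2, hence at most [e] times the square root of [N] once [N] exceeds
   [(2 / e) ^+ 2]. *)
- apply/eqoP => e e0; near=> N.
  have [le2 _ _ _] : good N (b N) by near: N.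
  apply: le_trans le2 _; rewrite ger0_norm ?sqrtr_ge0// mulrC -ler_pdivrMr//.
  have : Num.sqrt ((2 / e) ^+ 2) <= Num.sqrt (N%:R : R).
    by apply: ler_wsqrtr; near: N; exact: nbhs_infty_ger.
  by rewrite sqrtr_sqr ger0_norm// divr_ge0// ltW.
- apply/eqoP => e e0; near=> N.
  have [_ le2 _ _] : good N (b N) by near: N.
  apply: le_trans le2 _; rewrite ger0_norm// mulrC -ler_pdivrMr//.
  by near: N; exact: nbhs_infty_ger.
Unshelve. all: by end_near.
Qed.
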